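(* Let $\boldsymbol{\rho}=(\rho_1,\dots,\rho_m)$ and $\boldsymbol{\tau}=(\tau_1,\dots,\tau_n)$ be two contraction vectors, both of which are coplanar. Then $\mathcal{D}(\boldsymbol{\rho})\sim\mathcal{D}(\boldsymbol{\tau})$ if and only if there exist integers $p,q\ge1$ such that the $p$-th iteration $\boldsymbol{\rho}^p$ of $\boldsymbol{\rho}$ is a permutation of the $q$-th iteration $\boldsymbol{\tau}^q$ of $\boldsymbol{\tau}$.
   Context: Lipschitz equivalence. Fix $d\ge1$. Subsets $E,F\subset\mathbb{R}^d$ are Lipschitz equivalent, $E\sim F$, if there are a bijection $f:E\to F$ and a constant $C>0$ with $C^{-1}|x-y|\le|f(x)-f(y)|\le C|x-y|$ for all $x,y\in E$. Dust-like sets. For an iterated function system $\{\phi_j\}_{j=1}^m$ of contractive similarities of $\mathbb{R}^d$ with ratios $\rho_j\in(0,1)$, the attractor is the unique nonempty compact set $E$ with $E=\bigcup_{j=1}^m\phi_j(E)$; it is dust-like if the sets $\phi_1(E),\dots,\phi_m(E)$ are pairwise disjoint. A contraction vector is $\boldsymbol{\rho}=(\rho_1,\dots,\rho_m)$ with all $\rho_j\in(0,1)$ and $\sum_{j=1}^m\rho_j^d<1$. $\mathcal{D}(\boldsymbol{\rho})$ is the set of all dust-like self-similar sets in $\mathbb{R}^d$ with contraction ratios $\rho_1,\dots,\rho_m$. It is well known that all elements of $\mathcal{D}(\boldsymbol{\rho})$ are Lipschitz equivalent to each other; $\mathcal{D}(\boldsymbol{\rho})\sim\mathcal{D}(\boldsymbol{\tau})$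 means that $E\sim F$ for some (and thus for all) $E\in\mathcal{D}(\boldsymbol{\rho})$, $F\in\mathcal{D}(\boldsymbol{\tau})$. Pseudo-basis. $\langle\boldsymbol{\rho}\rangle=\langle\rho_1,\dots,\rho_m\rangle$ is the subgroup of the multiplicative group of positive reals generated by $\rho_1,\dots,\rho_m$; its rank is the cardinality of a basis of this free abelian group. Positive reals $\boldsymbol{\lambda}=(\lambda_1,\dots,\lambda_s)$ form a pseudo-basis of $\langle\boldsymbol{\rho}\rangle$ if $\langle\boldsymbol{\rho}\rangle\subset\langle\lambda_1,\dots,\lambda_s\rangle$ and $\operatorname{rank}\langle\boldsymbol{\rho}\rangle=s$. Then $x=(x_1,\dots,x_s)\mapsto\prod_{i=1}^s\lambda_i^{x_i}$ is an isomorphism $\mathbb{Z}^s\to\langle\boldsymbol{\lambda}\rangle$, and $\log_{\boldsymbol{\lambda}}:\langle\boldsymbol{\lambda}\rangle\to\mathbb{Z}^s$ denotes its inverse. Coplanarity. A contraction vector $\boldsymbol{\rho}$ of rank $s$ (i.e. $\operatorname{rank}\langle\boldsymbol{\rho}\rangle=s$) is coplanar if there is a pseudo-basis $\boldsymbol{\lambda}$ of $\langle\boldsymbol{\rho}\rangle$ such that the vectors $\log_{\boldsymbol{\lambda}}\rho_1,\dots,\log_{\boldsymbol{\lambda}}\rho_m$ all lie in a common (affine) hyperplane of $\mathbb{R}^s$. (This does not depend on the choice of pseudo-basis.) Iterations. For $k\ge1$, the $k$-th iteration of $\boldsymbol{\rho}$ is the vector $\boldsymbol{\rho}^k=(\rho_{\mathbf{i}})_{\mathbf{i}\in\{1,\dots,m\}^k}$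 with $\rho_{i_1\dots i_k}=\prod_{j=1}^k\rho_{i_j}$, the words $\mathbf{i}$ being ordered lexicographically. A vector is a permutation of another if they have the same length and the same entries counted with multiplicity.
   Formalization: The case m=n=1 is excluded (there the sets are single points and the claim fails, e.g. ρ=(1/2), τ=(1/3)), and D(ρ), D(τ) are assumed nonempty, as the notation D(ρ)~D(τ) presupposes. *)

(* Defs.v *)
From HB Require Import structures.
From mathcomp Require Import all_boot all_order all_algebra.
From mathcomp Require Import all_classical all_reals all_analysis.

Set Implicit Arguments.
Unset Strict Implicit.
Unset Printing Implicit Defensive.

Import Order.TTheory GRing.Theory Num.Theory.
Import numFieldNormedType.Exports.

Local Open Scope classical_set_scope.
Local Open Scope ring_scope.

(* The library norm on row vectors is the sup norm; similarities of R^d need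
   the Euclidean one. Both induce the topology used by [compact] below. *)
Definition enorm (R : realType) (d : nat) (x : 'rV[R]_d) : R :=
  Num.sqrt (\sum_(i < d) x 0 i ^+ 2).

Definition lipschitz_equiv (R : realType) (d : nat) (E F : set 'rV[R]_d) : Prop :=
  exists (f : 'rV[R]_d -> 'rV[R]_d) (C : R),
    [/\ 0 < C, set_bij E F f &
        forall x y, E x -> E y ->
          C^-1 * enorm (x - y) <= enorm (f x - f y) <= C * enorm (x - y)].

Definition similarity (R : realType) (d : nat) (r : R)
    (phi : 'rV[R]_d -> 'rV[R]_d) : Prop :=
  forall x y, enorm (phi x - phi y) = r * enorm (x - y).

Definition is_attractor (R : realType) (d m : nat)
    (phi : 'I_m -> 'rV[R]_d -> 'rV[R]_d) (E : set 'rV[R]_d) : Prop :=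
  [/\ E !=set0, compact E & E = \bigcup_(j in [set: 'I_m]) (phi j @` E)].

Definition contraction_vector (R : realType) (d m : nat)
    (rho : m.-tuple R) : Prop :=
  [/\ (0 < m)%N, forall j, 0 < tnth rho j < 1 &
      \sum_(j < m) tnth rho j ^+ d < 1].

Definition dustlike_sets (R : realType) (d m : nat) (rho : m.-tuple R) :
    set (set 'rV[R]_d) :=
  [set E | exists phi : 'I_m -> 'rV[R]_d -> 'rV[R]_d,
     [/\ forall j, similarity (tnth rho j) (phi j), is_attractor phi E &
         trivIset [set: 'I_m] (fun j => phi j @` E)]].

Definition dustlike_equiv (R : realType) (d m n : nat)
    (rho : m.-tuple R) (tau : n.-tuple R) : Prop :=
  exists E F : set 'rV[R]_d,
    [/\ dustlike_sets rho E, dustlike_sets tau F & lipschitz_equiv E F].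

Definition pos_subgroup (R : realType) (H : set R) : Prop :=
  [/\ forall x, H x -> 0 < x, H 1,
      forall x y, H x -> H y -> H (x * y) & forall x, H x -> H x^-1].

Definition gen_group (R : realType) (m : nat) (rho : m.-tuple R) : set R :=
  smallest (@pos_subgroup R) [set x | x \in rho].

Definition mul_exp (R : realType) (s : nat) (lambda : s.-tuple R)
    (x : 'rV[int]_s) : R :=
  \prod_(i < s) tnth lambda i ^ x 0 i.

Definition group_basis (R : realType) (H : set R) (s : nat)
    (b : s.-tuple R) : Prop :=
  [/\ forall i, 0 < tnth b i, gen_group b = H &
      forall x : 'rV[int]_s, mul_exp b x = 1 -> x = 0].

Definition has_rank (R : realType) (H : set R) (s : nat) : Prop :=
  exists b : s.-tuple R, group_basis H b.

Definition pseudo_basis (R : realType) (m s : nat) (rho : m.-tuple R)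
    (lambda : s.-tuple R) : Prop :=
  [/\ forall i, 0 < tnth lambda i, gen_group rho `<=` gen_group lambda &
      has_rank (gen_group rho) s].

(* The inverse of [mul_exp lambda]; the default value 0 is only taken outside
   the group generated by lambda. *)
Definition log_vec (R : realType) (s : nat) (lambda : s.-tuple R) (r : R) :
    'rV[int]_s :=
  xget 0 [set x | mul_exp lambda x = r].

Definition affine_hyperplane (R : realType) (s : nat) (P : set 'rV[R]_s) : Prop :=
  exists (a : 'rV[R]_s) (c : R),
    a != 0 /\ P = [set x | \sum_(i < s) a 0 i * x 0 i = c].

Definition coplanar (R : realType) (m : nat) (rho : m.-tuple R) : Prop :=
  exists (s : nat) (lambda : s.-tuple R) (P : set 'rV[R]_s),
    [/\ pseudo_basis rho lambda, affine_hyperplane P &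
        forall j, P (map_mx intr (log_vec lambda (tnth rho j)))].

(* Words of length k in lexicographic order. *)
Fixpoint words (m k : nat) : seq (seq 'I_m) :=
  if k is k'.+1 then [seq i :: w | i <- enum 'I_m, w <- words m k']
  else [:: [::]].

Definition iteration (R : realType) (m : nat) (rho : m.-tuple R) (k : nat) :
    seq R :=
  [seq \prod_(i <- w) tnth rho i | w <- words m k].

(* Main.v *)
Require Import Defs.
From mathcomp Require Import all_boot all_order all_algebra.
From mathcomp Require Import all_classical all_reals all_analysis.
From mathcomp Require Import ring zify.

(** Up to a bi-Lipschitz change, a dust-like set with ratios rho is the space of
infinite words over its maps, two words being at a distance given by the product of
the ratios along their common prefix ([dustlike_coding]). Lipschitz equivalence thus
becomes the existence of a bijection between two spaces of infinite words, called
addresses below, that distorts these prefix products by a bounded factor only.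

If rho^p and tau^q agree up to order, some bijection between the words of length p
and those of length q preserves products. Applying it block by block to infinite words
gives such a bijection of addresses ([iterates_comparable]).

The converse starts from a rigidity property of bi-Lipschitz bijections. Give each word
u over tau the mass tau_u^s, where sum tau_i^s = 1. The image of the cylinder of a word
w is a finite union of cylinders, all at a bounded depth below one cylinder of diameter
comparable to rho_w. Hence the density, the mass of this image divided by rho_w^s, is a
bounded function of w, and although it may take infinitely many values, the ratio of its
values at a child and at its parent takes only finitely many. At a word where the
density is close enough to its supremum no child can have a larger density; as the
density is an average over the children, it is constant below that word
([density_constant]). It follows that each word v over rho can be sent to a word Psi v
over tau with rho_v / tau_(Psi v) in a finite set, injectively on words of the same
length ([bilip_transfer]).

The rest is algebra. Coplanarity says that the product of a word determines its length
([coplanar_homogeneous]). By the pigeonhole principle some power of each rho_j is a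
quotient of products of the tau_i, so that the length of words over tau extends to a
rational degree N_j / D of rho_j, and symmetrically tau_i gets a degree M_i / D. For all
natural t and all x, z > 0 the weights rho_j^t x^D z^(N_j) and tau_i^t z^D x^(M_i) then
have comparable values on v and Psi v. With P and Q the sums of these weights, summing
over the words of length k compares P^k with a geometric series in Q, and the unit
level sets of P and Q coincide ([same_unit_level]).

At t = 0 this forces all N_j to be equal. Indeed, let y be a positive integer,
S(y) = sum y^(N_j) and w = S(y)^(1/D). The equality of the level sets reads
y^D * sum w^(-M_i) = 1, so that c y^D / w is an algebraic integer, where c is the number
of indices with the largest M_i. Its D-th power is rational, so S(y) divides a power of
c y^D; a suitable choice of y makes this impossible unless S is a monomial
([level_exponents_constant]). Once the N_j are equal, the equality of the level sets
says that a power of sum rho_j^t equals a power of sum tau_i^t, with exponents p and q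
that do not depend on t. These powers are the power sums of rho^p and tau^q, and power
sums determine a list up to order ([perm_eq_power_sums]). *)

Set Implicit Arguments.
Unset Strict Implicit.
Unset Printing Implicit Defensive.

Import Order.TTheory GRing.Theory Num.Theory.
Import numFieldNormedType.Exports.

Local Open Scope classical_set_scope.
Local Open Scope ring_scope.

(** * Words, addresses and cylinders *)

Definition wprod (R : realType) (m : nat) (a : 'I_m -> R) (w : seq 'I_m) : R :=
  \prod_(i <- w) a i.

(** An address codes a point of a dust-like set by the nested pieces that contain it. *)
Definition address (m : nat) := nat -> 'I_m.

Definition scons (m : nat) (i : 'I_m) (x : address m) : address m :=
  fun k => if k is k'.+1 then x k' else i.

Definition wapp (m : nat) (w : seq 'I_m) (x : address m) : address m :=
  foldr (@scons m) x w.

Definition cyl (m : nat) (w : seq 'I_m) : set (address m) :=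
  [set x | mkseq x (size w) = w].

Definition split_at (m : nat) (x y : address m) (k : nat) : Prop :=
  mkseq x k = mkseq y k /\ x k <> y k.

Section Words.
Variables (m : nat).
Implicit Types (x y : address m) (w u v : seq 'I_m).

Lemma mkseq_eqP x y k :
  mkseq x k = mkseq y k <-> forall i, (i < k)%N -> x i = y i.
Proof.
split=> [e i ik|e].
  by rewrite -(nth_mkseq (x 0%N) x ik) e nth_mkseq.
by apply/eq_in_map => i; rewrite mem_iota add0n => /andP[_]; exact: e.
Qed.

Lemma mkseq_scons i x k : mkseq (scons i x) k.+1 = i :: mkseq x k.
Proof. by rewrite /mkseq /= (iotaDl 1 0) -map_comp. Qed.

Lemma cyl_cons i w j x : cyl (i :: w) (scons j x) <-> i = j /\ cyl w x.
Proof. by rewrite /cyl /= mkseq_scons; split=> [[-> ->]|[-> ->]]. Qed.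

Lemma cyl_wapp w x : cyl w (wapp w x).
Proof. by elim: w => [//|i w IH]; apply/cyl_cons. Qed.

Lemma scons_shift x : scons (x 0%N) (fun k => x k.+1) = x.
Proof. by apply/funext => -[]. Qed.

Lemma wapp_shift w x : cyl w x -> wapp w (fun k => x (size w + k)%N) = x.
Proof.
elim: w x => [//|i w IH] x; rewrite -[x]scons_shift => /cyl_cons[-> xw].
by rewrite -[in RHS](IH _ xw).
Qed.

Lemma cyl_mkseq x k : cyl (mkseq x k) x.
Proof. by rewrite /cyl /= size_mkseq. Qed.

Lemma take_mkseq x k l : (k <= l)%N -> take k (mkseq x l) = mkseq x k.
Proof. by move=> kl; rewrite /mkseq -map_take take_iota (minn_idPl kl). Qed.

Lemma cyl_prefix w x k : cyl w x -> (k <= size w)%N -> mkseq x k = take k w.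
Proof. by move=> xw kw; rewrite -[in RHS]xw take_mkseq. Qed.

Lemma cyl_rcons w j x : cyl (rcons w j) x <-> cyl w x /\ x (size w) = j.
Proof.
rewrite /cyl /= size_rcons /mkseq -{1}addn1 iotaD map_cat /= add0n cats1.
by split=> [/rcons_inj[-> ->]|[-> ->]].
Qed.

(** Both words are prefixes of [x], so the longer one extends the shorter one. *)
Lemma cyl_comparable u v x : cyl u x -> cyl v x -> (size u <= size v)%N ->
  v = u ++ drop (size u) v.
Proof.
move=> xu xv uv; rewrite -[in LHS](cat_take_drop (size u) v); congr (_ ++ _).
by rewrite -(cyl_prefix xv uv).
Qed.

Lemma cyl_inj u v x : cyl u x -> cyl v x -> size u = size v -> u = v.
Proof. by move=> xu xv e; rewrite -xu e. Qed.

Lemma ex_split x y k : mkseq x k <> mkseq y k ->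
  exists2 l, (l < k)%N & split_at x y l.
Proof.
elim: k => [//|k IH] ne.
have [e|/IH[l lk h]] := pselect (mkseq x k = mkseq y k); last first.
  by exists l => //; exact: ltnW.
exists k => //; split=> // ek; apply: ne.
by rewrite /mkseq -addn1 iotaD !map_cat; congr (_ ++ _) => //=; rewrite add0n ek.
Qed.

Lemma split_lt x y k l : split_at x y k -> mkseq x l = mkseq y l -> (l <= k)%N.
Proof.
move=> [_ ne] /mkseq_eqP e; rewrite leqNgt; apply/negP => /e; exact: ne.
Qed.

Lemma neq_split x y : x <> y -> exists k, split_at x y k.
Proof.
move=> ne; have [k hk] : exists k, mkseq x k <> mkseq y k.
  apply: contrapT => h; apply: ne; apply/funext => k.
  have e : mkseq x k.+1 = mkseq y k.+1 by apply: contrapT => ne; apply: h; exists k.+1.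
  by move/mkseq_eqP: e; exact.
by have [l _ ?] := ex_split hk; exists l.
Qed.

Lemma split_neq x y k : split_at x y k -> x <> y.
Proof. by move=> [_ ne] e; apply: ne; rewrite e. Qed.

Lemma mem_words w : w \in words m (size w).
Proof.
elim: w => [//|i w IH] /=.
by apply/allpairsP; exists (i, w); rewrite mem_enum.
Qed.

Lemma size_words k w : w \in words m k -> size w = k.
Proof.
elim: k w => [|k IH] w /=; first by rewrite inE => /eqP->.
by case/allpairsP => -[i v] /= [_ /IH <- ->].
Qed.

Lemma uniq_words k : uniq (words m k).
Proof.
elim: k => [//|k IH] /=; apply: allpairs_uniq; rewrite ?enum_uniq//.
by move=> [i v] [j u] _ _ /= [-> ->].
Qed.

Definition short_words k : seq (seq 'I_m) :=
  flatten [seq words m l | l <- iota 0 k.+1].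

Lemma mem_short_words k w : (size w <= k)%N -> w \in short_words k.
Proof.
move=> wk; apply/flatten_mapP; exists (size w); last exact: mem_words.
by rewrite mem_iota add0n ltnS.
Qed.

End Words.

Lemma pow_small (R : realType) (c e : R) : 0 <= c < 1 -> 0 < e ->
  exists k, c ^+ k < e.
Proof.
move=> /andP[c0 c1] e0; have : (fun k => c ^+ k) @ \oo --> (0 : R).
  by apply: cvg_expr; rewrite ger0_norm.
move/cvgr0Pnorm_lt => /(_ _ e0)[k _ hk]; exists k.
by have := hk k (leqnn k); rewrite /= ger0_norm// exprn_ge0.
Qed.

Section Products.
Variables (R : realType) (m : nat) (a : 'I_m -> R).
Implicit Types (w u v : seq 'I_m).

Lemma wprod_nil : wprod a [::] = 1.
Proof. exact: big_nil. Qed.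

Lemma wprod_cons i w : wprod a (i :: w) = a i * wprod a w.
Proof. exact: big_cons. Qed.

Lemma wprod_cat u v : wprod a (u ++ v) = wprod a u * wprod a v.
Proof. exact: big_cat. Qed.

Lemma wprod_rcons w i : wprod a (rcons w i) = wprod a w * a i.
Proof. by rewrite -cats1 wprod_cat wprod_cons wprod_nil mulr1. Qed.

Lemma sum_words k : \sum_(w <- words m k) wprod a w = (\sum_i a i) ^+ k.
Proof.
elim: k => [|k IH] /=; first by rewrite big_seq1 wprod_nil.
rewrite big_allpairs_dep exprS -IH big_distrl big_enum; apply: eq_bigr => i _ /=.
by rewrite big_distrr; apply: eq_bigr => w _; rewrite wprod_cons.
Qed.

Hypothesis a01 : forall i, 0 < a i < 1.

Lemma a_gt0 i : 0 < a i. Proof. by have /andP[] := a01 i. Qed.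

Lemma wprod_gt0 w : 0 < wprod a w.
Proof. by apply: prodr_gt0 => i _; exact: a_gt0. Qed.
Hint Resolve wprod_gt0 : core.

Lemma wprod_le1 w : wprod a w <= 1.
Proof.
by rewrite /wprod big_seq prodr_ile1// => i _; have /andP[/ltW-> /ltW->] := a01 i.
Qed.

Lemma wprod_catl u v : wprod a (u ++ v) <= wprod a u.
Proof. by rewrite wprod_cat ler_piMr ?wprod_le1// ltW. Qed.

Lemma wprod_mkseq x k l : (k <= l)%N -> wprod a (mkseq x l) <= wprod a (mkseq x k).
Proof.
by move=> kl; rewrite -(cat_take_drop k (mkseq x l)) take_mkseq// wprod_catl.
Qed.

Lemma exists_min : exists2 c, 0 < c & forall i, c <= a i.
Proof.
exists (\big[Order.min/1]_i a i).
  by apply/bigmin_gtP; split=> // i _; exact: a_gt0.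
by move=> i; exact: bigmin_le_cond.
Qed.

Lemma exists_max : exists2 c, 0 <= c < 1 & forall i, a i <= c.
Proof.
exists (\big[Order.max/0]_i a i).
  apply/andP; split; first exact: bigmax_ge_id.
  by apply/bigmax_ltP; split=> // i _; have /andP[] := a01 i.
by move=> i; exact: le_bigmax_cond.
Qed.

Lemma wprod_small e : 0 < e -> exists k, forall w, (k <= size w)%N -> wprod a w < e.
Proof.
move=> e0; have [c /andP[c0 c1] ac] := exists_max.
have wc w : wprod a w <= c ^+ size w.
  elim: w => [|i w IH]; first by rewrite wprod_nil.
  rewrite wprod_cons exprS ler_pM// ?ac//; apply/ltW => //; exact: a_gt0.
have c01 : 0 <= c < 1 by rewrite c0.
have [k hk] := pow_small c01 e0; exists k => w kw.
by apply: le_lt_trans (wc w) (le_lt_trans _ hk); rewrite ler_wiXn2l// ltW.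
Qed.

End Products.

(** At the first differing index the prefix product is the distance of two addresses; this
is the bi-Lipschitz property of [g] with constant [C], written without a metric. *)
Definition comparable_addresses (R : realType) (m n : nat) (a : 'I_m -> R) (b : 'I_n -> R)
    (C : R) (g : address m -> address n) : Prop :=
  forall x y k l, split_at x y k -> split_at (g x) (g y) l ->
    wprod a (mkseq x k) <= C * wprod b (mkseq (g x) l) /\
    wprod b (mkseq (g x) l) <= C * wprod a (mkseq x k).

(** * Self-similar mass of a clopen set of addresses *)

Definition tail_set (n : nat) (u : seq 'I_n) (A : set (address n)) : set (address n) :=
  [set y | A (wapp u y)].

Definition saturated (n : nat) (K : nat) (A : set (address n)) : Prop :=
  forall x y, mkseq x K = mkseq y K -> A x -> A y.

(** The Bernoulli measure with weights [b], approximated from outside by cylinders of depth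
[K]. It is exact on [K]-saturated sets, which are the finite unions of such cylinders;
recursion is on the first letter. *)
Fixpoint mass (R : realType) (n : nat) (b : 'I_n -> R) (K : nat)
    (A : set (address n)) : R :=
  if K is K'.+1 then \sum_i b i * mass b K' (tail_set [:: i] A)
  else (`[< A !=set0 >])%:R.

Section Mass.
Variables (R : realType) (n : nat) (b : 'I_n -> R).
Implicit Types (A B : set (address n)).

Lemma mass0 K : mass b K set0 = 0.
Proof.
elim: K => [|K IH] /=.
  by rewrite (_ : `[< _ >] = false)//; apply/asboolP => -[].
by rewrite big1// => i _; rewrite (_ : tail_set _ _ = set0) ?IH ?mulr0.
Qed.

Lemma saturated_tail K i A : saturated K.+1 A -> saturated K (tail_set [:: i] A).
Proof.
by move=> sA x y e; apply: sA => /=; rewrite !mkseq_scons e.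
Qed.

Lemma saturated0 A x : saturated 0 A -> A x -> A = setT.
Proof. by move=> sA Ax; apply/seteqP; split=> // y _; exact: sA Ax. Qed.

Lemma saturatedS K L A : (K <= L)%N -> saturated K A -> saturated L A.
Proof.
move=> KL sA x y e; apply: sA.
by rewrite -(take_mkseq x KL) e take_mkseq.
Qed.

Lemma mass_wapp u K A : A `<=` cyl u ->
  mass b (size u + K) A = wprod b u * mass b K (tail_set u A).
Proof.
elim: u A => [|i u IH] A Au; first by rewrite wprod_nil mul1r.
rewrite /= (bigD1 i)//= big1 ?addr0 => [|j ji]; last first.
  rewrite (_ : tail_set _ _ = set0) ?mass0 ?mulr0//; apply/seteqP; split=> // y /=.
  by move/Au/cyl_cons => [/eqP]; rewrite eq_sym (negbTE ji).
by rewrite IH ?wprod_cons ?mulrA// => y /Au /cyl_cons[].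
Qed.

(** At depth 0 a saturated set is empty or everything, so at most one member of a disjoint
family is nonempty; the recursion distributes over the union. *)
Lemma mass_bigcup (J : finType) K (A : J -> set (address n)) :
  (forall j, saturated K (A j)) ->
  (forall i j x, A i x -> A j x -> i = j) ->
  mass b K (\bigcup_j A j) = \sum_j mass b K (A j).
Proof.
elim: K A => [|K IH] A sA dA /=.
  have [[x [j _ Ajx]]|none] := pselect (\bigcup_j A j !=set0); last first.
    rewrite (_ : `[< _ >] = false); last by apply/asboolP.
    rewrite big1// => j _; rewrite (_ : `[< _ >] = false)//.
    by apply/asboolP => -[x Ax]; apply: none; exists x, j.
  rewrite (_ : `[< _ >] = true); last by apply/asboolP; exists x, j.
  rewrite (bigD1 j)//= big1 ?addr0 => [|i ij].
    by rewrite (_ : `[< _ >] = true)//; apply/asboolP; exists x.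
  rewrite (_ : `[< _ >] = false)//; apply/asboolP => -[y Aiy].
  have Ajy : A j y by rewrite (saturated0 (sA j) Ajx).
  by move: ij; rewrite (dA i j y Aiy Ajy) eqxx.
rewrite exchange_big /=; apply: eq_bigr => i _; rewrite -big_distrr /= -IH.
- by congr (_ * mass b K _); apply/seteqP; split=> y [j _ h]; exists j.
- by move=> j; exact: saturated_tail.
- by move=> j k y; exact: dA.
Qed.

(** Only finitely many sets of words of length [K] exist. The list is built by recursion:
each value at depth [K.+1] is the weighted sum of a choice of values at depth [K]. *)
Lemma mass_finite K : exists S : seq R, forall A, mass b K A \in S.
Proof.
elim: K => [|K [S hS]] /=.
  by exists [:: 0; 1] => A; case: `[< _ >]; rewrite !inE eqxx ?orbT.
exists [seq \sum_i b i * nth 0 S (f i) | f : {ffun 'I_n -> 'I_(size S)}] => A.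
(* [f i] is the position in [S] of the mass of the tails that follow the letter [i]. *)
pose f := [ffun i => Ordinal (etrans (index_mem _ _) (hS (tail_set [:: i] A)))].
apply/mapP; exists f; first by rewrite mem_enum.
by apply: eq_bigr => i _; rewrite ffunE /= nth_index.
Qed.

Hypothesis b0 : forall i, 0 < b i.
Hypothesis sumb : \sum_i b i = 1.

Lemma mass_ge0 K A : 0 <= mass b K A.
Proof.
elim: K A => [|K IH] A /=; first exact: ler0n.
by apply: sumr_ge0 => i _; apply: mulr_ge0 => //; exact: ltW.
Qed.

Lemma mass_le1 K A : mass b K A <= 1.
Proof.
elim: K A => [|K IH] A /=; first by case: `[< _ >]; rewrite ?lexx ?ler01.
rewrite -[leRHS]sumb; apply: ler_sum => i _.
by apply: ler_piMr => //; exact: ltW.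
Qed.

Lemma mass_gt0 K A : A !=set0 -> 0 < mass b K A.
Proof.
elim: K A => [|K IH] A [x Ax] /=.
  by rewrite (_ : `[< _ >] = true) ?ltr01//; apply/asboolP; exists x.
rewrite (bigD1 (x 0%N))//=; apply: ltr_pwDl.
  apply: mulr_gt0 => //; apply: IH; exists (fun k => x k.+1).
  by rewrite /tail_set /= scons_shift.
by apply: sumr_ge0 => i _; apply: mulr_ge0; [exact: ltW | exact: mass_ge0].
Qed.

(** Since the weights sum to 1, splitting a cylinder into its children preserves its mass. *)
Lemma mass_stable K L A : (K <= L)%N -> saturated K A -> mass b L A = mass b K A.
Proof.
move=> /subnKC <-; move: (L - K)%N => {}L.
elim: K A => [|K IH] A sA; last first.
  rewrite addSn /=; apply: eq_bigr => i _; rewrite IH//; exact: saturated_tail.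
rewrite add0n; have [->|/set0P[x Ax]] := eqVneq A set0; first by rewrite !mass0.
rewrite (saturated0 sA Ax) {A sA Ax}; elim: L => [//|L IH].
transitivity (\sum_i b i * mass b 0 [set: address n]).
  by apply: eq_bigr => i _; congr (_ * _); exact: IH.
by rewrite -big_distrl sumb /= mul1r.
Qed.

End Mass.

(** * Rigidity of bi-Lipschitz maps of addresses *)

Definition cyl_image (m n : nat) (g' : address n -> address m) (w : seq 'I_m) :
    set (address n) := g' @^-1` cyl w.

Section Envelope.
Variables (R : realType) (m n : nat) (a : 'I_m -> R) (b : 'I_n -> R).
Hypothesis (a01 : forall i, 0 < a i < 1) (b01 : forall i, 0 < b i < 1).
Variables (g : address m -> address n) (g' : address n -> address m) (C : R).
Hypothesis (gK : cancel g g') (gK' : cancel g' g) (C1 : 1 <= C).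
Hypothesis gC : comparable_addresses a b C g.

Let C0 : 0 < C. Proof. exact: lt_le_trans C1. Qed.

(** The word [u w] is the longest prefix of the image of one point of the cylinder of [w]
whose product still exceeds the bound [C * wprod a w] on the diameter of the image, or is
empty: every other image point then shares this prefix. *)
Lemma exists_envelope (i0 : 'I_m) : exists (C2 : R) (u : seq 'I_m -> seq 'I_n),
  0 < C2 /\ forall w, [/\ cyl_image g' w `<=` cyl (u w), wprod a w <= wprod b (u w) &
    wprod b (u w) <= C2 * wprod a w].
Proof.
have [c c0 cb] := exists_min b01.
exists (C / c).
suff /choice[u hu] : forall w, exists u, [/\ cyl_image g' w `<=` cyl u,
    wprod a w <= wprod b u & wprod b u <= C / c * wprod a w].
  by exists u; split=> //; exact: divr_gt0.
move=> w; pose x := wapp w (fun=> i0); pose y := g x.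
have xw : cyl w x by exact: cyl_wapp.
have [k0 hk0] := wprod_small b01 (mulr_gt0 C0 (wprod_gt0 a01 w)).
have ex : exists k, wprod b (mkseq y k.+1) <= C * wprod a w.
  by exists k0; apply/ltW/hk0; rewrite size_mkseq.
case: (ex_minnP ex) => k hk kmin.
have big k' : k = k'.+1 -> C * wprod a w < wprod b (mkseq y k).
  by move=> e; rewrite ltNge e; apply/negP => /kmin; rewrite e ltnn.
exists (mkseq y k); split.
- move=> y' y'w; rewrite /cyl /= size_mkseq; apply: contrapT => ne'.
  have ne : mkseq y k <> mkseq y' k by move=> /esym.
  have [l lk sl] := ex_split ne.
  have [p sp] : exists p, split_at x (g' y') p.
    apply: neq_split => e; apply: (split_neq sl).
    by rewrite /y e gK'.
  have wp : (size w <= p)%N by apply: (split_lt sp); rewrite xw y'w.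
  have sl' : split_at (g x) (g (g' y')) l by rewrite gK'.
  have [_ h] := gC sp sl'.
  have kk : k = k.-1.+1 by rewrite prednK// (leq_trans _ lk).
  have := big _ kk; apply/negP; rewrite -leNgt.
  apply: le_trans (wprod_mkseq b01 _ (ltnW lk)) _; apply: le_trans h _.
  rewrite ler_pM2l//; apply: le_trans (wprod_mkseq a01 _ wp) _.
  by rewrite xw.
- case: k {hk kmin} big => [_|k /(_ k erefl) /ltW h]; first by rewrite wprod_nil wprod_le1.
  by apply: le_trans h; rewrite ler_peMl// ltW// wprod_gt0.
- rewrite mulrAC ler_pdivlMr//; apply: le_trans hk.
  by rewrite mkseqS wprod_rcons ler_pM2l ?wprod_gt0.
Qed.

(** The cylinder of [w] is separated from its complement by at least [wprod a w], so its image
is separated from the image of the complement by a fixed fraction of it; cylinders a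
bounded number of letters below [u w] are too small to meet both. *)
Lemma exists_depth (C2 : R) (u : seq 'I_m -> seq 'I_n) : 0 < C2 ->
  (forall w, cyl_image g' w `<=` cyl (u w)) ->
  (forall w, wprod b (u w) <= C2 * wprod a w) ->
  exists L, forall w, saturated (size (u w) + L) (cyl_image g' w).
Proof.
move=> C20 uw uC.
have e0 : 0 < (C * C2)^-1 by rewrite invr_gt0 mulr_gt0.
have [L hL] := wprod_small b01 e0; exists L => w y y' e yw.
apply: contrapT => y'w.
have ne : mkseq (g' y) (size w) <> mkseq (g' y') (size w).
  by rewrite yw => e'; exact: y'w.
have [p pw sp] := ex_split ne.
have [l sl] : exists l, split_at y y' l.
  by apply: neq_split => e'; apply: (split_neq sp); rewrite e'.
have Kl := split_lt sl e.
have sl' : split_at (g (g' y)) (g (g' y')) l by rewrite !gK'.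
have [h _] := gC sp sl'; rewrite gK' in h.
have h1 : wprod a w <= wprod a (mkseq (g' y) p).
  by rewrite -[X in wprod a X <= _]yw wprod_mkseq// ltnW.
have h2 := wprod_mkseq b01 y Kl.
pose v := drop (size (u w)) (mkseq y (size (u w) + L)).
have ev : mkseq y (size (u w) + L) = u w ++ v.
  have yu := uw _ _ yw.
  apply: (cyl_comparable yu (cyl_mkseq _ _)).
  by rewrite size_mkseq leq_addr.
have h3 : wprod b v < (C * C2)^-1.
  by apply: hL; rewrite /v size_drop size_mkseq addKn.
have h4 : wprod b (mkseq y (size (u w) + L)) < C^-1 * wprod a w.
  rewrite ev wprod_cat; apply: le_lt_trans (_ : _ <= C2 * wprod a w * wprod b v) _.
    by rewrite ler_pM2r ?wprod_gt0.
  rewrite mulrAC; rewrite ltr_pM2r ?wprod_gt0//.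
  by rewrite mulrC -ltr_pdivlMr// -invfM.
have := le_lt_trans h2 h4; rewrite mulrC ltr_pdivlMr// mulrC.
by apply/negP; rewrite -leNgt; apply: le_trans h1 h.
Qed.

End Envelope.

Lemma wprod_powR (R : realType) (m : nat) (a : 'I_m -> R) (s : R) w :
  (forall i, 0 < a i < 1) -> wprod (fun i => a i `^ s) w = wprod a w `^ s.
Proof.
move=> a01; elim: w => [|i w IH]; first by rewrite !wprod_nil powR1.
by rewrite !wprod_cons IH powRM ?ltW ?wprod_gt0//; have /andP[] := a01 i.
Qed.

Lemma mem_mulr (R : realType) (S1 S2 : seq R) x y : x \in S1 -> y \in S2 ->
  x * y \in [seq x * y | x <- S1, y <- S2].
Proof. exact: allpairs_f. Qed.

Lemma seq_gap (R : realType) (S : seq R) :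
  exists2 e, 0 < e & forall q, q \in S -> q < 1 + e -> q <= 1.
Proof.
elim: S => [|q S [e e0 IH]]; first by exists 1.
have [q1|q1] := leP q 1.
  by exists e => // r; rewrite inE => /predU1P[->//|]; exact: IH.
exists (Num.min e (q - 1)); first by rewrite lt_min e0 subr_gt0.
move=> r rS; rewrite -ltrBlDl lt_min => /andP[re rq].
case/predU1P: rS => [rE|rS]; last by apply: IH => //; rewrite -ltrBlDl.
by rewrite rE ltxx in rq.
Qed.

Section MassOfImages.
Variables (R : realType) (m n : nat) (a : 'I_m -> R) (b : 'I_n -> R).
Hypothesis (a01 : forall i, 0 < a i < 1) (b01 : forall i, 0 < b i < 1).
Variables (g : address m -> address n) (g' : address n -> address m).
Hypothesis (gK : cancel g g').
Variables (i0 : 'I_m) (C : R) (u : seq 'I_m -> seq 'I_n) (L : nat).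
Hypothesis (C0 : 0 < C) (uw : forall w, cyl_image g' w `<=` cyl (u w)).
Hypothesis (au : forall w, wprod a w <= wprod b (u w)).
Hypothesis (ua : forall w, wprod b (u w) <= C * wprod a w).
Hypothesis (uL : forall w, saturated (size (u w) + L) (cyl_image g' w)).
Variables (s t : R).
Hypothesis (s0 : 0 < s) (t0 : 0 < t).
Hypothesis (sums : \sum_i a i `^ s = 1) (sumt : \sum_i b i `^ t = 1).

Let al i := a i `^ s.
Let be i := b i `^ t.
Let al0 i : 0 < al i. Proof. by rewrite powR_gt0//; have /andP[] := a01 i. Qed.
Let be0 i : 0 < be i. Proof. by rewrite powR_gt0//; have /andP[] := b01 i. Qed.
Let wal0 w : 0 < wprod al w. Proof. by rewrite wprod_powR// powR_gt0// wprod_gt0. Qed.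
Let wbe0 w : 0 < wprod be w. Proof. by rewrite wprod_powR// powR_gt0// wprod_gt0. Qed.

Lemma cyl_image_neq0 w : cyl_image g' w !=set0.
Proof. by exists (g (wapp w (fun=> i0))); rewrite /cyl_image /= gK; exact: cyl_wapp. Qed.

(** The depth is one at which the image is saturated, so this is its exact mass. *)
Definition image_mass w : R := mass be (size (u w) + L) (cyl_image g' w).

Let sigma w := mass be L (tail_set (u w) (cyl_image g' w)).

Let image_massE w : image_mass w = wprod be (u w) * sigma w.
Proof. exact: mass_wapp. Qed.

Let sigma_gt0 w : 0 < sigma w.
Proof.
by rewrite -(pmulr_rgt0 _ (wbe0 (u w))) -image_massE; apply/mass_gt0/cyl_image_neq0.
Qed.

Lemma image_mass_gt0 w : 0 < image_mass w.
Proof. by rewrite image_massE mulr_gt0. Qed.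

(** The images of the children are resolved at different depths; [mass_stable] brings them to
a common one. *)
Lemma image_mass_split w : image_mass w = \sum_j image_mass (rcons w j).
Proof.
pose K := maxn (size (u w) + L) (\max_j (size (u (rcons w j)) + L)).
have Kj j : (size (u (rcons w j)) + L <= K)%N.
  by rewrite leq_max; apply/orP; right; exact: leq_bigmax.
rewrite /image_mass -(mass_stable sumt (leq_maxl _ _ : _ <= K)%N (@uL w)).
rewrite (_ : cyl_image g' w = \bigcup_j cyl_image g' (rcons w j)); last first.
  apply/seteqP; split=> y.
    by move=> yw; exists (g' y (size w)) => //; apply/cyl_rcons.
  by move=> [j _ /cyl_rcons[]].
rewrite mass_bigcup.
- by apply: eq_bigr => j _; rewrite (mass_stable sumt (Kj j) (@uL _)).
- by move=> j; exact: saturatedS (Kj j) (@uL _).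
- by move=> i j y /cyl_rcons[_ <-] /cyl_rcons[_ <-].
Qed.

(** The image lies in the cylinder of [u w], whose product is at most [C * wprod a w]. *)
Lemma image_mass_le w : image_mass w <= C `^ t * wprod a w `^ t.
Proof.
have w0 := ltW (wprod_gt0 a01 w); have v0 := ltW (wprod_gt0 b01 (u w)).
have C0' := ltW C0; have wb0 := ltW (wbe0 (u w)).
rewrite -powRM//; have h : wprod be (u w) <= (C * wprod a w) `^ t.
  by rewrite wprod_powR//; apply: ge0_ler_powR; rewrite ?nnegrE ?mulr_ge0// ltW.
apply: le_trans h.
by rewrite image_massE ler_piMr// mass_le1// => i; exact: be0.
Qed.

(** The density of the image mass is a weighted average over the children, hence at most its
largest value on a child. *)
Lemma exists_heavy_child w : exists j,
  image_mass w * wprod al (rcons w j) <= image_mass (rcons w j) * wprod al w.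
Proof.
apply: contrapT => h.
suff : image_mass w * wprod al w < image_mass w * wprod al w by rewrite ltxx.
rewrite [ltLHS](_ : _ = \sum_j image_mass (rcons w j) * wprod al w); last first.
  by rewrite -big_distrl -image_mass_split.
rewrite [ltRHS](_ : _ = \sum_j image_mass w * wprod al (rcons w j)); last first.
  rewrite -[in LHS](mulr1 (wprod al w)) -sums !big_distrr /=; apply: eq_bigr => j _.
  by rewrite wprod_rcons.
apply: ltr_sum => [|j _]; first by apply/hasP; exists i0; rewrite ?mem_index_enum.
by rewrite ltNge; apply/negP => hj; apply: h; exists j.
Qed.

Lemma heavy_word k : exists2 w, size w = k &
  image_mass [::] * wprod al w <= image_mass w.
Proof.
elim: k => [|k [w <- hw]]; first by exists [::]; rewrite // wprod_nil mulr1.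
have [j hj] := exists_heavy_child w; exists (rcons w j); first by rewrite size_rcons.
rewrite -(ler_pM2r (wal0 w)); apply: le_trans hj.
by rewrite mulrAC ler_pM2r.
Qed.

(** If [t] were larger than [s], the mass of images would be negligible against
[wprod a w `^ s] for long [w], against [heavy_word]. This is the invariance of dimension. *)
Lemma exponent_le : t <= s.
Proof.
rewrite leNgt; apply/negP => st; have d0 : 0 < t - s by rewrite subr_gt0.
pose e := image_mass [::] / C `^ t.
have e0 : 0 < e by rewrite divr_gt0 ?image_mass_gt0 ?powR_gt0.
have [k hk] := wprod_small a01 (powR_gt0 (t - s)^-1 e0).
have [w wk hw] := heavy_word k.
have := le_trans hw (image_mass_le w); rewrite wprod_powR//.
have w0 := wprod_gt0 a01 w; have w0' := ltW w0.
have -> : wprod a w `^ t = wprod a w `^ (t - s) * wprod a w `^ s.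
  by rewrite -powRD ?subrK// gt_eqF ?implybT.
rewrite mulrA ler_pM2r ?powR_gt0// mulrC -ler_pdivrMr ?powR_gt0//.
apply/negP; rewrite -ltNge -/e.
have -> : e = (e `^ (t - s)^-1) `^ (t - s).
  by rewrite -powRrM mulVf ?powRr1 ?ltW ?gt_eqF.
apply: gt0_ltr_powR; rewrite ?nnegrE ?powR_ge0//.
by apply: hk; rewrite wk.
Qed.

Definition density w : R := image_mass w / wprod al w.

Let density_gt0 w : 0 < density w.
Proof. by rewrite divr_gt0 ?image_mass_gt0. Qed.

(** The words [u w] and [u (rcons w j)] are prefixes of a common address and their products
are comparable, so one extends the other by a word of bounded length. *)
Lemma envelope_jump : exists S : seq R, forall w j,
  wprod be (u (rcons w j)) / wprod be (u w) \in S.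
Proof.
have [c c0 ca] := exists_min a01.
have [B hB] := wprod_small b01 (divr_gt0 c0 C0).
have short v : c / C <= wprod b v -> v \in short_words n B.
  move=> h; apply: mem_short_words; rewrite leqNgt; apply/negP => /ltnW /hB.
  by rewrite ltNge h.
pose S := [seq wprod be v | v <- short_words n B].
exists (S ++ [seq x^-1 | x <- S]) => w j; rewrite mem_cat; apply/orP.
have [y yw] := cyl_image_neq0 (rcons w j).
have yu' := uw yw; have yu : cyl (u w) y by apply: uw; case/cyl_rcons: yw.
have bu0 v : 0 < wprod b v by exact: wprod_gt0.
have := au (rcons w j); have := ua w; have := au w; have := ua (rcons w j).
rewrite wprod_rcons => h1 h2 h3 h4.
have [le|/ltnW le] := leqP (size (u w)) (size (u (rcons w j))); [left|right].
- have e := cyl_comparable yu yu' le; set v := drop _ _ in e.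
  rewrite e wprod_cat mulrC mulKf ?gt_eqF//; apply: map_f; apply: short.
  rewrite e wprod_cat in h4; rewrite ler_pdivrMr//; apply: le_trans (ca j) _.
  rewrite -(ler_pM2l (wprod_gt0 a01 w)); apply: le_trans h4 _.
  apply: le_trans (ler_wpM2r (ltW (bu0 _)) h3) _.
  by rewrite le_eqVlt; apply/orP; left; apply/eqP; ring.
- have e := cyl_comparable yu' yu le; set v := drop _ _ in e.
  have -> : wprod be (u (rcons w j)) / wprod be (u w) = (wprod be v)^-1.
    by rewrite e wprod_cat invfM mulrA mulfV ?gt_eqF// mul1r.
  apply/map_f/map_f/short; rewrite e wprod_cat in h2.
  rewrite ler_pdivrMr// -(ler_pM2l (wprod_gt0 a01 w)).
  have aj : a j <= 1 by have /andP[_ /ltW] := a01 j.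
  have w0 := wprod_gt0 a01 w.
  apply: le_trans (_ : wprod a w * a j <= _); first by rewrite ler_pM2l.
  apply: le_trans (_ : wprod a w <= _); first by rewrite ler_piMr// ltW.
  have h : wprod b (u (rcons w j)) <= C * wprod a w.
    by apply: le_trans h1 _; rewrite ler_pM2l// ler_piMr// ltW.
  apply: le_trans h2 _; apply: le_trans (ler_wpM2r (ltW (bu0 _)) h) _.
  by rewrite le_eqVlt; apply/orP; left; apply/eqP; ring.
Qed.

(** The density itself may take infinitely many values, since [wprod b (u w) / wprod a w] may;
this factor changes by finitely many ratios only from a word to its child. *)
Lemma density_jump : exists S : seq R, forall w j,
  density (rcons w j) / density w \in S.
Proof.
have [S1 h1] := envelope_jump; have [S2 h2] := mass_finite be L.
pose S3 := [seq x * y^-1 | x <- S2, y <- S2]; pose S4 := [seq (al j)^-1 | j : 'I_m].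
exists [seq x * y | x <- [seq x * y | x <- S1, y <- S3], y <- S4] => w j.
have -> : density (rcons w j) / density w =
    wprod be (u (rcons w j)) / wprod be (u w) * (sigma (rcons w j) / sigma w) / al j.
  rewrite /density !image_massE wprod_rcons.
  by field; rewrite !gt_eqF.
apply: mem_mulr; first apply: mem_mulr => //.
  by apply: (allpairs_f (fun x y : R => x * y^-1)); exact: h2.
by apply: map_f; rewrite mem_enum.
Qed.

Lemma density_average w : density w = \sum_j al j * density (rcons w j).
Proof.
rewrite /density image_mass_split big_distrl; apply: eq_bigr => j _ /=.
by rewrite wprod_rcons; field; rewrite !gt_eqF.
Qed.

(** Choose [w] with density so close to the supremum that a jump by a ratio above 1, which is
at least [1 + e] by finiteness, is excluded. All children then have at most the density of
their parent, so exactly that density as it is their average, and this propagates down. *)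
Lemma density_constant : t = s ->
  exists w, forall v, density (w ++ v) = density w.
Proof.
move=> ts; have [S hS] := density_jump; have [e e0 he] := seq_gap S.
pose D := range density.
have supD : has_sup D.
  split; first by exists (density [::]), [::].
  exists (C `^ t) => _ [w _ <-]; rewrite /density ler_pdivrMr//.
  by apply: le_trans (image_mass_le w) _; rewrite wprod_powR// ts.
have leD w : density w <= sup D by apply: sup_upper_bound => //; exists w.
have D0 : 0 < sup D by apply: lt_le_trans (leD [::]).
have e1 : 0 < 1 + e by rewrite addr_gt0.
(* This gap is such that a density above it times [1 + e] exceeds the supremum. *)
have [_ [w _ <-] hw] := sup_adherent (divr_gt0 (mulr_gt0 D0 e0) e1) supD.
have near : sup D < density w * (1 + e).
  rewrite -ltr_pdivrMr//; apply: le_lt_trans hw; rewrite le_eqVlt; apply/orP; left.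
  by apply/eqP; field; rewrite gt_eqF.
exists w; elim/last_ind => [|v j IH]; first by rewrite cats0.
rewrite -rcons_cat; move: (w ++ v) IH => w' IH.
have le k : density (rcons w' k) <= density w'.
  rewrite -[leRHS]mul1r -ler_pdivrMr//; apply: he => //.
  by rewrite ltr_pdivrMr// mulrC IH; apply: le_lt_trans near.
rewrite -IH; apply/eqP; rewrite eq_le le leNgt /=; apply/negP => lt.
suff : density w' < density w' by rewrite ltxx.
rewrite [ltLHS]density_average -[ltRHS]mul1r -sums big_distrl /=.
rewrite (bigD1 j)//= [ltRHS](bigD1 j)//=; apply: ltr_leD.
  by rewrite ltr_pM2l//; exact: al0.
by apply: ler_sum => k _; rewrite ler_pM2l//; exact: al0.
Qed.

End MassOfImages.

(** The combinatorial trace of a bi-Lipschitz bijection: products are matched up to finitely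
many ratios, without collisions among words of the same length. *)
Definition transfer (R : realType) (m n : nat) (a : 'I_m -> R) (b : 'I_n -> R) : Prop :=
  exists (Psi : seq 'I_m -> seq 'I_n) (A : seq R),
    (forall v, wprod a v / wprod b (Psi v) \in A) /\
    (forall v v', size v = size v' -> Psi v = Psi v' -> v = v').

Section Transfer.
Variables (R : realType) (m n : nat) (a : 'I_m -> R) (b : 'I_n -> R).
Hypothesis (a01 : forall i, 0 < a i < 1) (b01 : forall i, 0 < b i < 1).
Variables (g : address m -> address n) (g' : address n -> address m) (C : R).
Hypothesis (gK : cancel g g') (gK' : cancel g' g) (C1 : 1 <= C).
Hypothesis gC : comparable_addresses a b C g.
Variables (i0 : 'I_m) (s t : R).
Hypothesis (s0 : 0 < s) (t0 : 0 < t).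
Hypothesis (sums : \sum_i a i `^ s = 1) (sumt : \sum_i b i `^ t = 1).

Lemma bilip_exponent_le : t <= s.
Proof.
have [C2 [u [C20 hu]]] := exists_envelope a01 b01 gK' C1 gC i0.
have [L uL] : exists L, forall w, saturated (size (u w) + L) (cyl_image g' w).
  by apply: (exists_depth a01 b01 gK' C1 gC C20) => w; have [] := hu w.
have uw w : cyl_image g' w `<=` cyl (u w) by have [] := hu w.
have ua w : wprod b (u w) <= C2 * wprod a w by have [] := hu w.
exact: (exponent_le a01 b01 gK i0 C20 uw ua uL t0 sums sumt).
Qed.

(** Below the word [w0] of constant density, [wprod a v `^ s] and [wprod b (u (w0 ++ v)) `^ s]
differ by a factor from the finite list of masses. Extending [u (w0 ++ v)] by [L] letters to
a word [Psi v] whose cylinder lies inside the image makes cylinders of distinct words of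
equal length disjoint, whence injectivity. *)
Lemma bilip_transfer : t = s -> transfer a b.
Proof.
move=> ts.
have [C2 [u [C20 hu]]] := exists_envelope a01 b01 gK' C1 gC i0.
have [L uL] : exists L, forall w, saturated (size (u w) + L) (cyl_image g' w).
  by apply: (exists_depth a01 b01 gK' C1 gC C20) => w; have [] := hu w.
have uw w : cyl_image g' w `<=` cyl (u w) by have [] := hu w.
have au w : wprod a w <= wprod b (u w) by have [] := hu w.
have ua w : wprod b (u w) <= C2 * wprod a w by have [] := hu w.
have [w0 hw0] := density_constant a01 b01 gK i0 C20 uw au ua uL t0 sums sumt ts.
pose y v : address n := g (wapp (w0 ++ v) (fun=> i0)).
have yw v : cyl_image g' (w0 ++ v) (y v) by rewrite /cyl_image /= gK; exact: cyl_wapp.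
pose tl v := drop (size (u (w0 ++ v))) (mkseq (y v) (size (u (w0 ++ v)) + L)).
pose Psi v := u (w0 ++ v) ++ tl v.
have PsiE v : Psi v = mkseq (y v) (size (u (w0 ++ v)) + L).
  have yu := uw _ _ (yw v).
  apply/esym/(cyl_comparable yu (cyl_mkseq _ _)).
  by rewrite size_mkseq leq_addr.
have [S hS] := mass_finite (fun i => b i `^ t) L.
(* By constancy of the density, [c * (wprod a v / wprod b (u (w0 ++ v))) `^ s]
   is the mass of the tail set of the image of [w0 ++ v]. *)
pose c := wprod (fun i => a i `^ s) w0 * density a b g' u L s t w0.
pose T := [seq (x / c) `^ s^-1 | x <- S]; pose T' := [seq (wprod b v)^-1 | v <- words n L].
exists Psi, [seq x * y | x <- T, y <- T']; split=> [v|v v' sz e].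
  have bu0 := wprod_gt0 b01 (u (w0 ++ v)); have av0 := wprod_gt0 a01 v.
  have -> : wprod a v / wprod b (Psi v) =
      wprod a v / wprod b (u (w0 ++ v)) * (wprod b (tl v))^-1.
    by rewrite wprod_cat invfM mulrA.
  apply: mem_mulr; last first.
    apply: map_f; have <- : size (tl v) = L by rewrite size_drop size_mkseq addKn.
    exact: mem_words.
  set q := _ / _; have q0 : 0 <= q by rewrite ltW// divr_gt0.
  have -> : q = (mass (fun i => b i `^ t) L (tail_set (u (w0 ++ v)) (cyl_image g' (w0 ++ v)))
      / c) `^ s^-1; last exact/map_f/hS.
  have pa w : 0 < wprod (fun i => a i `^ s) w.
    by rewrite wprod_powR// powR_gt0// wprod_gt0.
  rewrite -[LHS]powRr1// -(divff (lt0r_neq0 s0)) powRrM; congr (_ `^ _).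
  set w := w0 ++ v; set sg := mass _ _ _.
  have sg0 : 0 < sg.
    apply: mass_gt0 => [i|]; first by rewrite powR_gt0//; have /andP[] := b01 i.
    have yu := uw _ _ (yw v); exists (fun k => y v (size (u w) + k)%N).
    rewrite /tail_set /= (_ : wapp _ _ = y v)//; first exact: yw.
    exact: wapp_shift.
  have qE : q `^ s * wprod b (u w) `^ s = wprod a v `^ s.
    by rewrite -powRM// ?divfK ?gt_eqF// ltW.
  have bs0 : 0 < wprod b (u w) `^ s by exact: powR_gt0.
  have ws0 : 0 < wprod (fun i => a i `^ s) w0 by [].
  have as0 : 0 < wprod a v `^ s by exact: powR_gt0.
  have -> : c = wprod b (u w) `^ s * sg / wprod a v `^ s.
    rewrite /c -(hw0 v) /density /image_mass mass_wapp// wprod_cat -/w -/sg.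
    rewrite (wprod_powR _ _ b01) (wprod_powR _ v a01) ts.
    by field; rewrite !gt_eqF.
  by rewrite -qE; field; rewrite !gt_eqF// -(pmulr_lgt0 _ bs0) qE.
have yv' : cyl_image g' (w0 ++ v') (y v).
  apply: (@uL _ (y v')) (yw v'); rewrite -PsiE -e.
  apply/esym; have := PsiE v; rewrite e {1}PsiE => h.
  have := congr1 size h; rewrite !size_mkseq => ->; rewrite -h; exact/esym/PsiE.
have := cyl_inj (yw v) yv'; rewrite !size_cat sz => /(_ erefl) /eqP.
by rewrite eqseq_cat// eqxx => /eqP.
Qed.

End Transfer.

(** * Exponential sums with the same unit level set *)

(** Clearing denominators in a monic equation for [c / S] shows that [S] divides the leading
term [c ^ k]. *)
Lemma integral_ratio_dvd (R : realType) (c S : nat) : (0 < S)%N ->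
  integralOver (intr : int -> R) (c%:R / S%:R) -> exists k, (S %| c ^ k)%N.
Proof.
move=> S0 [p pmon /eqP]; rewrite horner_coef size_map_poly_id0; last first.
  by rewrite (monicP pmon) rmorph1 oner_neq0.
have sp : (0 < size p)%N by rewrite lt0n size_poly_eq0 monic_neq0.
set k := (size p).-1; rewrite -(prednK sp) -/k => h; exists k.
have SR : S%:R != 0 :> R by rewrite pnatr_eq0 -lt0n.
have key : \sum_(i < k.+1) p`_i * c%:Z ^+ i * S%:Z ^+ (k - i) = 0.
  apply/eqP; rewrite -(eqr_int R) rmorph_sum /=; apply/eqP.
  have := congr1 ( *%R (S%:R ^+ k)) h; rewrite mulr0 big_distrr /= => h'.
  rewrite -[RHS]h'; apply: eq_bigr => i _.
  rewrite coef_map /= !rmorphM /= !rmorphXn /= expr_div_n.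
  have ik : (i <= k)%N by rewrite -ltnS.
  have -> : S%:R ^+ k = S%:R ^+ (k - i) * S%:R ^+ i :> R by rewrite -exprD subnK.
  rewrite -!pmulrn.
  by field; rewrite expf_neq0.
have : (S%:Z %| c%:Z ^+ k)%Z.
  rewrite big_ord_recr /= subnn mulr1 in key.
  have -> : c%:Z ^+ k = - \sum_(i < k) p`_i * c%:Z ^+ i * S%:Z ^+ (k - i).
    have lc : p`_k = 1 by exact/monicP.
    by apply/eqP; move/eqP: key; rewrite lc mul1r addrC addr_eq0.
  rewrite rpredN rpred_sum// => i _; apply: dvdz_mull.
  by rewrite -(prednK (_ : 0 < k - i)%N) ?subn_gt0// exprS dvdz_mulr.
by rewrite dvdzE abszX !absz_nat.
Qed.

Lemma nat_root (R : realType) (D : nat) (S : R) : (0 < D)%N -> 0 < S ->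
  exists2 w, 0 < w & w ^+ D = S.
Proof.
move=> D0 S0; exists (S `^ (D%:R)^-1); first exact: powR_gt0.
by rewrite -powR_mulrn ?powR_ge0// -powRrM mulVf ?powRr1 ?ltW// pnatr_eq0 -lt0n.
Qed.

Section UnitLevel.
Variables (R : realType) (m n D : nat) (N : 'I_m -> nat) (M : 'I_n -> nat).
Hypothesis D0 : (0 < D)%N.
Hypothesis M0 : forall i, (0 < M i)%N.
Hypothesis level : forall x z : R, 0 < x -> 0 < z ->
  x ^+ D * (\sum_j z ^+ N j) = 1 -> z ^+ D * (\sum_i x ^+ M i) = 1.

(** With [w] the [D]-th root of [S = \sum_j y ^ N j], the hypothesis at [x = w^-1] and [z = y]
becomes a polynomial relation for [w] whose only term without a factor [w] is [b * y ^ D].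
So [b * y ^ D / w] is integral, and its [D]-th power is rational with denominator [S]. *)
Lemma sum_pow_dvd (i0 : 'I_n) (j0 : 'I_m) :
  exists2 b : nat, (0 < b)%N & forall y, (0 < y)%N ->
    exists k, (\sum_j y ^ N j %| (b * y ^ D) ^ k)%N.
Proof.
pose i1 := [arg max_(i > i0) M i].
have Mmax i : (M i <= M i1)%N by rewrite /i1; case: arg_maxnP => // k _; exact.
exists #|[pred i | M i == M i1]|.
  by apply/card_gt0P; exists i1; rewrite inE eqxx.
set b := #|_| => y y0; set S := (\sum_j _)%N.
have S0 : (0 < S)%N by rewrite /S (bigD1 j0)//= ltn_addr// expn_gt0 y0.
have SR : 0 < S%:R :> R by rewrite ltr0n.
have [w w0 wS] := nat_root D0 SR.
have wn0 := lt0r_neq0 w0.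
have := @level w^-1 y%:R; rewrite invr_gt0 ltr0n exprVn wS => /(_ w0 y0).
have -> : \sum_j y%:R ^+ N j = S%:R :> R.
  by rewrite natr_sum; apply: eq_bigr => j _; rewrite natrX. 
rewrite mulVf ?gt_eqF// => /(_ erefl) key.
pose r := w ^+ (M i1).-1 - \sum_(i | M i != M i1) y%:R ^+ D * w ^+ (M i1 - M i).-1.
have rE : (b * y ^ D)%:R = w * r.
  have key' : \sum_i y%:R ^+ D * w ^+ (M i1 - M i) = w ^+ M i1.
    have := congr1 ( *%R (w ^+ M i1)) key; rewrite mulr1 => <-.
    rewrite mulrCA !big_distrr /=; apply: eq_bigr => i _; congr (_ * _).
    by rewrite exprVn -[in RHS](subnK (Mmax i)) exprD mulfK ?expf_neq0.
  rewrite /r mulrBr -exprS prednK// -key' (bigID (fun i => M i == M i1)) /=.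
  have -> : \sum_(i | M i == M i1) y%:R ^+ D * w ^+ (M i1 - M i) = (b * y ^ D)%:R :> R.
    rewrite natrM natrX mulr_natl -sumr_const; apply: eq_big => [i|i /eqP ->].
      by rewrite inE.
    by rewrite subnn mulr1.
  rewrite big_distrr /= -addrA -sumrB big1 ?addr0// => i ne.
  have lt : (0 < M i1 - M i)%N by rewrite subn_gt0 ltn_neqAle ne Mmax.
  by rewrite mulrCA -exprS prednK// subrr.
have wint k : integralOver (intr : int -> R) (w ^+ k).
  have wI : integralOver (intr : int -> R) w.
    exists ('X^D - S%:Z%:P); first exact: monicXnsubC.
    by rewrite rmorphB /= map_polyXn map_polyC /= /root !hornerE wS subrr.
  elim: k => [|k IH]; first exact: integral1.
  by rewrite exprS; exact: integral_mul.
have rint : integralOver (intr : int -> R) r.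
  apply: integral_sub; first exact: wint.
  apply: (big_ind (integralOver (intr : int -> R))) => [|p q|i _].
  - exact: (integral_nat _ 0).
  - exact: integral_add.
  apply: integral_mul; last exact: wint.
  by rewrite -natrX; exact: integral_nat.
have rD : integralOver (intr : int -> R) (r ^+ D).
  by elim: (D) => [|k IH]; [exact: integral1 | rewrite exprS; exact: integral_mul].
have : integralOver (intr : int -> R) (((b * y ^ D) ^ D)%:R / S%:R).
  by rewrite natrX rE exprMn wS mulrC mulKf ?gt_eqF.
move=> /(integral_ratio_dvd S0)[k hk].
by exists (D * k)%N; rewrite expnM.
Qed.

(** Let [b0] be the number of smallest exponents. For [y = b * b0 ^ 2] the sum is
[y ^ N j0 * b0 * (1 + b * b0 * T)] with [T > 0] unless all exponents agree; the last factor
is prime to [b] and [b0], hence to [y], and cannot divide a power of [b * y ^ D]. *)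
Lemma level_exponents_constant (i0 : 'I_n) : forall j j', N j = N j'.
Proof.
suff main j0 j1 : (forall j, N j0 <= N j)%N -> N j1 = N j0.
  move=> j j'; pose j0 := [arg min_(i < j) N i].
  have h k : (N j0 <= N k)%N by rewrite /j0; case: arg_minnP => // l _; exact.
  by rewrite (main j0 j)// (main j0 j').
move=> Nmin; apply: contrapT => ne.
have lt1 : (N j0 < N j1)%N by rewrite ltn_neqAle Nmin andbT; apply/eqP => /esym.
have [b b_gt0 hb] := sum_pow_dvd i0 j0.
pose b0 := #|[pred j | N j == N j0]|.
have b0_gt0 : (0 < b0)%N by apply/card_gt0P; exists j0; rewrite inE eqxx.
(* With the square, [y / b0] keeps a factor [b0], which makes [q] prime to [b0]. *)
pose y := (b * b0 ^ 2)%N; have y0 : (0 < y)%N by rewrite muln_gt0 b_gt0 expn_gt0 b0_gt0.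
pose T := (\sum_(j | N j != N j0) y ^ (N j - N j0).-1)%N.
have T0 : (0 < T)%N.
  rewrite /T (bigD1 j1) /=; last by apply/eqP.
  by rewrite ltn_addr// expn_gt0 y0.
pose q := (1 + b * b0 * T)%N.
have SE : (\sum_j y ^ N j = y ^ N j0 * (b0 * q))%N.
  transitivity (y ^ N j0 * (b0 + y * T))%N; last by rewrite /q /y; congr (_ * _)%N; ring.
  rewrite mulnDr (bigID (fun j => N j == N j0)) /=; congr (_ + _)%N.
    rewrite mulnC -sum_nat_const; apply: eq_big => [j|j /eqP->//].
    by rewrite inE.
  rewrite /T !big_distrr /=; apply: eq_bigr => j nj.
  have lt : (0 < N j - N j0)%N by rewrite subn_gt0 ltn_neqAle eq_sym nj Nmin.
  by rewrite -expnS prednK// -expnD subnKC.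
have [k hk] := hb y y0.
have qS : (q %| (b * y ^ D) ^ k)%N.
  by apply: dvdn_trans hk; rewrite SE mulnA dvdn_mull.
have qb : coprime q b by rewrite /coprime gcdnC /q -mulnA addnC mulnC gcdnMDl gcdn1.
have qb0 : coprime q b0 by rewrite /coprime gcdnC /q mulnAC addnC gcdnMDl gcdn1.
have : coprime q ((b * y ^ D) ^ k).
  by rewrite coprimeXr// coprimeMr qb coprimeXr// /y coprimeMr qb coprimeXr.
rewrite /coprime (gcdn_idPl qS) /q -[X in _ == X]addn0 eqn_add2l.
by rewrite !muln_eq0 !eqn0Ngt b_gt0 b0_gt0 T0.
Qed.

End UnitLevel.

(** * Weighted word sums and power sums *)

Lemma le1_of_bounded_powers (R : realType) (x K : R) : 0 <= x ->
  (forall k, x ^+ k <= K) -> x <= 1.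
Proof.
move=> x0 h; rewrite leNgt; apply/negP => x1.
have K0 : 0 < K by apply: lt_le_trans (h 0%N); rewrite expr0.
have x0' : 0 < x by exact: lt_trans x1.
have c01 : 0 <= x^-1 < 1 by rewrite invr_ge0 x0 invf_lt1.
have Ki : 0 < K^-1 by rewrite invr_gt0.
have [k] := pow_small c01 Ki.
by rewrite exprVn ltf_pV2 ?posrE ?exprn_gt0// ltNge h.
Qed.

Lemma ler_sum_subseq (R : realType) (T : eqType) (F : T -> R) (s1 s2 : seq T) :
  (forall x, 0 <= F x) -> uniq s1 -> {subset s1 <= s2} ->
  \sum_(x <- s1) F x <= \sum_(x <- s2) F x.
Proof.
move=> F0; elim: s1 s2 => [|x s1 IH] s2 /=.
  by rewrite big_nil => _ _; exact: sumr_ge0.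
move=> /andP[xs us] sub.
rewrite big_cons [leRHS](big_rem x) /=; last by apply: sub; exact: mem_head.
rewrite lerD2l; apply: IH => // y ys.
apply: rem_mem; last by apply: sub; rewrite inE ys orbT.
by apply: contraNneq xs => <-.
Qed.

Lemma geometric_le (R : realType) (q : R) k : 0 <= q < 1 ->
  \sum_(l <- iota 0 k) q ^+ l <= (1 - q)^-1.
Proof.
move=> /andP[q0 q1]; have d0 : 0 < 1 - q by rewrite subr_gt0.
rewrite -[leRHS]mul1r ler_pdivlMr// mulrC.
suff -> : (1 - q) * \sum_(l <- iota 0 k) q ^+ l = 1 - q ^+ k.
  by rewrite gerBl exprn_ge0.
elim: k => [|k IH]; first by rewrite big_nil mulr0 expr0 subrr.
by rewrite -addn1 iotaD big_cat big_seq1 mulrDr IH add0n addn1 exprS; ring.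
Qed.

(** The function factors through the finite set of keys. *)
Lemma bounded_of_finite_key (R : realType) (T : Type) (key f : T -> R) (A : seq R) :
  (forall x, key x \in A) -> (forall x y, key x = key y -> f x = f y) ->
  exists C, forall x, f x <= C.
Proof.
move=> hA hf; suff [C hC] : exists C, forall x, key x \in A -> f x <= C.
  by exists C => x; exact: hC.
elim: A {hA} => [|k A [C hC]]; first by exists 0.
have [[x0 kx0]|none] := pselect (exists x, key x = k).
  exists (Num.max C (f x0)) => x; rewrite inE le_max => /orP[/eqP kx|/hC->//].
  by rewrite (hf x x0) ?kx// lexx orbT.
exists C => x; rewrite inE => /orP[/eqP kx|/hC//].
by exfalso; apply: none; exists x.
Qed.

(** The k-th power of [\sum_j A j] is the weight of all words of length [k]. By the transfer it
is at most a constant times the weight of distinct words over [b], bounded by the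
convergent geometric series in [\sum_i B i]. Bounded powers force a sum of at most 1. *)
Lemma transfer_sum_le (R : realType) (m n : nat) (a A : 'I_m -> R) (b B : 'I_n -> R) :
  (forall j, 0 < A j) -> (forall i, 0 < B i) ->
  (forall v u v' u', wprod a v / wprod b u = wprod a v' / wprod b u' ->
     wprod A v / wprod B u = wprod A v' / wprod B u') ->
  transfer a b -> \sum_i B i < 1 -> \sum_j A j <= 1.
Proof.
move=> A0 B0 AB [Psi [S [PS Pinj]]] B1.
have WA v : 0 < wprod A v by apply: prodr_gt0.
have WB v : 0 < wprod B v by apply: prodr_gt0.
have [C hC] := @bounded_of_finite_key R _ (fun v => wprod a v / wprod b (Psi v))
  (fun v => wprod A v / wprod B (Psi v)) S PS (fun v v' => AB v _ v' _).
have C0 : 0 <= C by apply: le_trans (hC [::]); rewrite ltW// divr_gt0.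
have SB0 : 0 <= \sum_i B i by apply: sumr_ge0 => i _; exact: ltW.
apply: (@le1_of_bounded_powers _ _ (C * (1 - \sum_i B i)^-1)) => [|k].
  by apply: sumr_ge0 => i _; exact: ltW.
rewrite -sum_words.
apply: (@le_trans _ _ (\sum_(v <- words m k) C * wprod B (Psi v))).
  by apply: ler_sum => v _; rewrite -ler_pdivrMr.
rewrite -big_distrr /=; apply: ler_wpM2l => //.
rewrite -(big_map Psi xpredT (wprod B)).
pose L := \max_(v <- words m k) size (Psi v).
apply: le_trans (_ : \sum_(u <- short_words n L) wprod B u <= _).
  apply: ler_sum_subseq => [u||u]; first exact: ltW.
    rewrite map_inj_in_uniq ?uniq_words// => v v' /size_words vk /size_words v'k.
    by apply: Pinj; rewrite vk v'k.
  move=> /mapP[v vk ->]; apply: mem_short_words.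
  by rewrite /L (big_rem v)//= leq_maxl.
rewrite /short_words big_flatten big_map.
under eq_bigr do rewrite sum_words.
by apply: geometric_le; rewrite SB0.
Qed.

(** Power sums give the sum of any polynomial over each list; the polynomial vanishing at all
entries but [x] isolates the multiplicity of [x]. *)
Lemma perm_eq_power_sums (R : realType) (s1 s2 : seq R) :
  (forall t : nat, \sum_(r <- s1) r ^+ t = \sum_(r <- s2) r ^+ t) -> perm_eq s1 s2.
Proof.
move=> h.
have hp (p : {poly R}) : \sum_(r <- s1) p.[r] = \sum_(r <- s2) p.[r].
  under eq_bigr do rewrite horner_coef; under [RHS]eq_bigr do rewrite horner_coef.
  rewrite exchange_big [RHS]exchange_big /=; apply: eq_bigr => i _.
  by rewrite -!big_distrr /= h.
apply/allP => x _ /=.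
pose p : {poly R} := \prod_(y <- undup (s1 ++ s2) | y != x) ('X - y%:P).
have px : p.[x] != 0.
  rewrite horner_prod prodf_seq_neq0; apply/allP => y _; apply/implyP => yx.
  by rewrite hornerXsubC subr_eq0 eq_sym.
have sE s : {subset s <= s1 ++ s2} -> \sum_(r <- s) p.[r] = p.[x] *+ count_mem x s.
  move=> sub; rewrite -iter_addr_0 -big_const_seq.
  rewrite (bigID (pred1 x)) /= [X in _ + X]big1_seq ?addr0.
    by apply: eq_bigr => r /eqP->.
  move=> r /andP[rx rs]; rewrite horner_prod (big_rem r) /=; last first.
    by rewrite mem_undup sub.
  by rewrite rx hornerXsubC subrr mul0r.
have := hp p; rewrite !sE => [|r rs|r rs]; rewrite ?mem_cat ?rs ?orbT//.
move/eqP; rewrite -subr_eq0 -[X in X - _]mulr_natr -[X in _ - X]mulr_natr -mulrBr.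
by rewrite mulf_eq0 (negbTE px) /= subr_eq0 eqr_nat.
Qed.

(** * Rational degrees and equality of power sums *)

(** All generators have degree 1 for a grading of the multiplicative group that they span:
this is what coplanarity provides. *)
Definition homogeneous (R : realType) (m : nat) (a : 'I_m -> R) : Prop :=
  forall w w', wprod a w = wprod a w' -> size w = size w'.

Definition wdeg (m : nat) (N : 'I_m -> int) (w : seq 'I_m) : int := \sum_(i <- w) N i.

Section Degree.
Variables (R : realType) (m n : nat) (a : 'I_m -> R) (b : 'I_n -> R).
Hypothesis (a01 : forall i, 0 < a i < 1) (b01 : forall i, 0 < b i < 1).

Lemma wprod_nseq k j : wprod a (nseq k j) = a j ^+ k.
Proof. by elim: k => [|k IH]; rewrite ?wprod_nil// wprod_cons IH exprS. Qed.

Lemma wprod_flatten (s : seq (seq 'I_n)) : wprod b (flatten s) = \prod_(w <- s) wprod b w.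
Proof. by elim: s => [|w s IH] /=; rewrite ?big_nil ?wprod_nil// wprod_cat big_cons IH. Qed.

Lemma wprod_flatten_nseq k (w : seq 'I_n) :
  wprod b (flatten (nseq k w)) = wprod b w ^+ k.
Proof. by rewrite wprod_flatten; elim: k => [|k IH]; rewrite ?big_nil//= big_cons IH exprS. Qed.

Lemma size_flatten_nseq k (w : seq 'I_n) : size (flatten (nseq k w)) = (k * size w)%N.
Proof. by elim: k => [//|k IH] /=; rewrite size_cat IH mulSn. Qed.

(** The ratios attached to the powers of the letter [j] lie in a finite set, so two powers have
the same ratio; their quotient is a quotient of products over [b]. *)
Lemma transfer_root j : transfer a b -> exists k (al be : seq 'I_n),
  (0 < k)%N /\ a j ^+ k * wprod b be = wprod b al.
Proof.
move=> [Psi [A [hA _]]].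
pose f l := wprod a (nseq l j) / wprod b (Psi (nseq l j)).
(* Among [size A + 1] powers of the letter, two have the same ratio. *)
have [l [l' [ll' fll']]] : exists l l', (l < l')%N /\ f l = f l'.
  apply: contrapT => none.
  have : uniq [seq f l | l <- iota 0 (size A).+1].
    rewrite map_inj_in_uniq ?iota_uniq// => l l' _ _ e; apply/eqP.
    by case: ltngtP => // h; exfalso; apply: none; [exists l, l' | exists l', l].
  move/uniq_leq_size => /(_ A); rewrite size_map size_iota ltnn => h.
  by have : false by apply: h => _ /mapP[l _ ->]; exact: hA.
exists (l' - l)%N, (Psi (nseq l' j)), (Psi (nseq l j)); split.
  by rewrite subn_gt0.
have w0 l0 : wprod b (Psi (nseq l0 j)) != 0 by rewrite gt_eqF// wprod_gt0.
have al0 : a j ^+ l != 0 by rewrite gt_eqF// exprn_gt0//; have /andP[] := a01 j.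
move/eqP: fll'; rewrite /f !wprod_nseq eqr_div// => /eqP.
have -> : a j ^+ l' = a j ^+ (l' - l) * a j ^+ l by rewrite -exprD subnK// ltnW.
move=> e; apply: (mulfI al0); rewrite e; ring.
Qed.

Lemma transfer_common_root : transfer a b -> exists D (al be : 'I_m -> seq 'I_n),
  (0 < D)%N /\ forall j, a j ^+ D * wprod b (be j) = wprod b (al j).
Proof.
move=> tab; have /choice[k /choice[al /choice[be h]]] :
  forall j, exists k al be, (0 < k)%N /\ a j ^+ k * wprod b be = wprod b al.
  by move=> j; exact: transfer_root.
pose D := (\prod_j k j)%N.
pose e j := (\prod_(i | i != j) k i)%N.
have De j : D = (k j * e j)%N by rewrite /D (bigD1 j).
exists D, (fun j => flatten (nseq (e j) (al j))), (fun j => flatten (nseq (e j) (be j))).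
split; first by apply: prodn_gt0 => j; have [] := h j.
move=> j; rewrite !wprod_flatten_nseq (De j) exprM -exprMn; have [_ ->//] := h j.
Qed.

(** The integer [N j] is [D] times the degree of [a j] in the grading of [b] by word length, with
[a j ^+ D] written as a quotient of two products over [b]. Comparing [D]-th powers, an
equality of ratios becomes an equality of two products over [b], hence of lengths. *)
Lemma transfer_degree : homogeneous b -> transfer a b ->
  exists D (N : 'I_m -> int), (0 < D)%N /\ forall v u v' u',
    wprod a v / wprod b u = wprod a v' / wprod b u' ->
    wdeg N v - (D * size u)%:Z = wdeg N v' - (D * size u')%:Z.
Proof.
move=> hb /transfer_common_root[D [al [be [D0 h]]]].
exists D, (fun j => (size (al j))%:Z - (size (be j))%:Z); split=> // v u v' u' e.
pose X (f : 'I_m -> seq 'I_n) w := flatten (map f w).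
have hX w : wprod a w ^+ D * wprod b (X be w) = wprod b (X al w).
  elim: w => [|j w IH]; first by rewrite /X /= !wprod_nil expr1n mul1r.
  by rewrite wprod_cons exprMn /X /= !wprod_cat -h -IH; ring.
have degE w : wdeg (fun j => (size (al j))%:Z - (size (be j))%:Z) w =
    (size (X al w))%:Z - (size (X be w))%:Z.
  rewrite /wdeg; elim: w => [|j w IH]; first by rewrite big_nil subrr.
  by rewrite big_cons IH /X /= !size_cat !PoszD; ring.
have u0 w : wprod b w != 0 by rewrite gt_eqF// wprod_gt0.
have e' : wprod a v * wprod b u' = wprod a v' * wprod b u.
  by move/eqP: e; rewrite eqr_div// => /eqP.
have /hb : wprod b (X al v ++ X be v' ++ flatten (nseq D u')) =
    wprod b (X al v' ++ X be v ++ flatten (nseq D u)).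
  rewrite !wprod_cat -!hX !wprod_flatten_nseq.
  transitivity ((wprod a v * wprod b u') ^+ D * wprod b (X be v) * wprod b (X be v')).
    by rewrite exprMn; ring.
  by rewrite e' exprMn; ring.
rewrite !size_cat !size_flatten_nseq !degE => /(congr1 Posz); rewrite !PoszD; lia.
Qed.

End Degree.

(** Scaling [x] multiplies [P] by a known power and moves [Q] continuously. If [Q] were not 1
at a point with [P] equal to 1, a small scaling would bring [P] and [Q] strictly to opposite
sides of 1, against the two implications. *)
Lemma same_unit_level (R : realType) (m n D : nat) (c : 'I_m -> R) (d : 'I_n -> R)
    (N : 'I_m -> nat) (M : 'I_n -> nat)
    (P := fun x z => x ^+ D * \sum_j c j * z ^+ N j)
    (Q := fun x z => z ^+ D * \sum_i d i * x ^+ M i) :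
  (0 < D)%N -> (forall i, 0 <= d i) ->
  (forall x z : R, 0 < x -> 0 < z -> Q x z < 1 -> P x z <= 1) ->
  (forall x z : R, 0 < x -> 0 < z -> P x z < 1 -> Q x z <= 1) ->
  forall x z : R, 0 < x -> 0 < z -> P x z = 1 -> Q x z = 1.
Proof.
move=> D0 d0 QP PQ x z x0 z0 Pxz.
(* The successor makes scaling by a [K]-th root change [Q] strictly less than needed to cross 1. *)
pose K := (\max_i M i).+1.
have PE y : P (y * x) z = y ^+ D by rewrite /P exprMn -mulrA -/(P x z) Pxz mulr1.
have le_scale y : 1 <= y -> Q (y * x) z <= y ^+ K.-1 * Q x z.
  move=> y1; rewrite mulrCA ler_pM2l ?exprn_gt0// big_distrr /=.
  apply: ler_sum => i _; rewrite mulrCA ler_wpM2l// exprMn ler_wpM2r ?exprn_ge0 ?(ltW x0)//.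
  by apply: ler_weXn2l => //; exact: leq_bigmax.
have ge_scale y : 0 < y <= 1 -> y ^+ K.-1 * Q x z <= Q (y * x) z.
  move=> /andP[y0 y1]; rewrite mulrCA ler_pM2l ?exprn_gt0// big_distrr /=.
  apply: ler_sum => i _; rewrite mulrCA ler_wpM2l// exprMn ler_wpM2r ?exprn_ge0 ?(ltW x0)//.
  by apply: ler_wiXn2l => //; [exact: ltW | exact: leq_bigmax].
have Qge0 : 0 <= Q x z.
  apply: mulr_ge0; first exact/exprn_ge0/ltW.
  by apply: sumr_ge0 => i _; apply: mulr_ge0 => //; apply/exprn_ge0/ltW.
have Qpos : 0 < Q x z.
  rewrite lt_neqAle Qge0 andbT; apply/eqP => Q0.
  have two : 1 <= 2 :> R by rewrite ler1n.
  have x2 : 0 < 2 * x by rewrite mulr_gt0.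
  have : Q (2 * x) z < 1 by apply: le_lt_trans (le_scale _ two) _; rewrite -Q0 mulr0.
  by move/(QP _ _ x2 z0); rewrite PE leNgt exprn_egt1 ?ltr1n// -lt0n D0.
have K0 : (0 < K)%N by [].
apply/eqP; rewrite eq_le; apply/andP; split; rewrite leNgt; apply/negP => h.
(* Case [Q > 1]: dividing [x] by [y] makes [P] smaller than 1 and keeps [Q] at least [y]. *)
- have [y y0 yK] := nat_root K0 Qpos.
  have y1 : 1 < y by rewrite -(@expr_gt1 _ K)// ?(ltW y0)// yK.
  have yi0 : 0 < y^-1 by rewrite invr_gt0.
  have yi1 : y^-1 < 1 by rewrite invf_lt1.
  have := PQ (y^-1 * x) z (mulr_gt0 yi0 x0) z0; rewrite PE exprn_ilt1 ?(ltW yi0)// -?lt0n//.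
  move=> /(_ D0); apply/negP; rewrite -ltNge.
  apply: lt_le_trans (ge_scale _ _); last by rewrite yi0 ltW.
  by rewrite -yK exprVn exprS mulrC mulfK ?expf_neq0 ?gt_eqF.
(* Case [Q < 1]: multiplying [x] by [y] makes [P] larger than 1 and keeps [Q] at most [1 / y]. *)
- have [y y0 yK] : exists2 y, 0 < y & y ^+ K = (Q x z)^-1.
    by apply: nat_root => //; rewrite invr_gt0.
  have y1 : 1 < y by rewrite -(@expr_gt1 _ K)// ?(ltW y0)// yK invf_gt1.
  have := QP (y * x) z (mulr_gt0 y0 x0) z0; rewrite PE => H.
  have : y ^+ D <= 1.
    apply: H; apply: le_lt_trans (le_scale _ (ltW y1)) _.
    have -> : Q x z = (y ^+ K)^-1 by rewrite yK invrK.
    by rewrite exprS invfM mulrCA mulfV ?mulr1 ?invf_lt1// expf_neq0// gt_eqF.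
  by rewrite leNgt exprn_egt1// -lt0n D0.
Qed.

Lemma wprod_weight (R : realType) (m : nat) (a : 'I_m -> R) (N : 'I_m -> int)
    (x z : R) (t D : nat) v : 0 < x -> 0 < z ->
  wprod (fun j => a j ^+ t * x ^+ D * z ^ N j) v =
    wprod a v ^+ t * x ^ (D * size v)%:Z * z ^ wdeg N v.
Proof.
move=> x0 z0; elim: v => [|j v IH].
  by rewrite !wprod_nil expr1n muln0 expr0z /wdeg big_nil expr0z !mul1r.
rewrite !wprod_cons IH /wdeg big_cons exprMn mulnS PoszD !expfzDr ?gt_eqF//.
by rewrite -!exprnP; ring.
Qed.

(** On a pair of words the ratio of the two weights is a function of the ratio of their
products, by the invariance of both degrees; so [transfer_sum_le] applies. *)
Lemma transfer_weight_le (R : realType) (m n : nat) (a : 'I_m -> R) (b : 'I_n -> R)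
    (D : nat) (N : 'I_m -> int) (M : 'I_n -> int) (t : nat) (x z : R) :
  (forall i, 0 < a i < 1) -> (forall i, 0 < b i < 1) ->
  (forall v u v' u', wprod a v / wprod b u = wprod a v' / wprod b u' ->
    wdeg N v - (D * size u)%:Z = wdeg N v' - (D * size u')%:Z) ->
  (forall v u v' u', wprod a v / wprod b u = wprod a v' / wprod b u' ->
    (D * size v)%:Z - wdeg M u = (D * size v')%:Z - wdeg M u') ->
  transfer a b -> 0 < x -> 0 < z ->
  \sum_i (b i ^+ t * z ^+ D * x ^ M i) < 1 ->
  \sum_j (a j ^+ t * x ^+ D * z ^ N j) <= 1.
Proof.
move=> a01 b01 hN hM tab x0 z0.
have pos k (c : 'I_k -> R) (K : 'I_k -> int) y y' : (forall i, 0 < c i < 1) ->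
    0 < y -> 0 < y' -> forall i, 0 < c i ^+ t * y ^+ D * y' ^ K i.
  move=> c01 y0 y'0 i; have /andP[c0 _] := c01 i.
  by rewrite !mulr_gt0 ?exprn_gt0 ?exprz_gt0.
apply: transfer_sum_le (tab) => [||v u v' u' e]; [exact: pos | exact: pos |].
have ratio w w' : wprod (fun j => a j ^+ t * x ^+ D * z ^ N j) w /
    wprod (fun i => b i ^+ t * z ^+ D * x ^ M i) w' =
    (wprod a w / wprod b w') ^+ t * x ^ ((D * size w)%:Z - wdeg M w') *
    z ^ (wdeg N w - (D * size w')%:Z).
  rewrite !wprod_weight// !expfzDr ?gt_eqF// expr_div_n -!invr_expz.
  by field; rewrite !expf_neq0 ?expfz_neq0 ?gt_eqF// wprod_gt0.
by rewrite !ratio e (hN _ _ _ _ e) (hM _ _ _ _ e).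
Qed.

(** For small [x] the first sum is below 1, while a single nonpositive exponent would give a
term at least 1 in the second one, which has another positive term. *)
Lemma unit_sum_degree_gt0 (R : realType) (m n D : nat) (M : 'I_n -> int) :
  (0 < D)%N -> (1 < n)%N ->
  (forall x : R, 0 < x -> \sum_(j < m) x ^+ D < 1 -> \sum_i x ^ M i <= 1) ->
  forall i, 0 < M i.
Proof.
move=> D0 n1 h i; rewrite ltNge; apply/negP => Mi.
(* Small enough for [m * x ^ D < 1]. *)
pose x : R := (m.+1)%:R^-1.
have x0 : 0 < x by rewrite invr_gt0 ltr0n.
have x1 : x <= 1 by rewrite invf_le1 ?ltr0n// ler1n.
have /implyP := h x x0; apply/negP; rewrite negb_imply -ltNge; apply/andP; split.
  rewrite sumr_const card_ord -[in X in X < _]mulr_natl.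
  apply: le_lt_trans (_ : m%:R * x < 1); last by rewrite ltr_pdivrMr ?mul1r ?ltr_nat ?ltr0n.
  by rewrite ler_wpM2l// -[leRHS]expr1 ler_wiXn2l// ltW.
have [k kE] : exists k, M i = - k%:Z by exists `|M i|%N; rewrite lez0_abs// opprK.
have [i' ii'] : exists i', i' != i.
  have c2 : (0 < #|predC1 i|)%N by rewrite cardC1 card_ord -subn1 subn_gt0.
  by have /card_gt0P[i'] := c2; exists i'.
rewrite (bigD1 i)//= kE -exprnN -exprVn.
apply: lt_le_trans (_ : 1 < 1 + \sum_(j | j != i) x ^ M j) _.
  rewrite ltrDl (bigD1 i')//= ltr_pwDl ?exprz_gt0//.
  by apply: sumr_ge0 => j _; apply/exprz_ge0/ltW.
by rewrite lerD2r exprn_ege1// -[leLHS]invr1 lef_pV2 ?posrE.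
Qed.

(** With all [N j] equal to [k], the first sum at [x = 1] is [z ^+ k * \sum_j a j ^+ t]. Choosing
[z] to make it 1, the second sum gives [\sum_i b i ^+ t = z ^- D], so both sides are powers
of [z]: [p = D] and [q = k] for every [t]. *)
Lemma power_identity (R : realType) (m n : nat) (a : 'I_m -> R) (b : 'I_n -> R) :
  (forall i, 0 < a i < 1) -> (forall i, 0 < b i < 1) -> (1 < m)%N -> (1 < n)%N ->
  homogeneous a -> homogeneous b -> transfer a b -> transfer b a ->
  exists p q, [/\ (1 <= p)%N, (1 <= q)%N &
    forall t, (\sum_j a j ^+ t) ^+ p = (\sum_i b i ^+ t) ^+ q].
Proof.
move=> a01 b01 m1 n1 ha hb tab tba.
have [D1 [N1 [D1p hN1]]] := transfer_degree a01 b01 hb tab.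
have [D2 [M2 [D2p hM2]]] := transfer_degree b01 a01 ha tba.
(* Both degrees are written over the common denominator [D]. *)
pose D := (D1 * D2)%N; have D0 : (0 < D)%N by rewrite muln_gt0 D1p.
pose N j := N1 j * D2%:Z; pose M i := M2 i * D1%:Z.
have wN v : wdeg N v = wdeg N1 v * D2%:Z by rewrite /wdeg big_distrl.
have wM v : wdeg M v = wdeg M2 v * D1%:Z by rewrite /wdeg big_distrl.
have inv v u v' u' : wprod b u / wprod a v = wprod b u' / wprod a v' ->
    wprod a v / wprod b u = wprod a v' / wprod b u'.
  by move=> e; rewrite -[LHS]invf_div e invf_div.
have inv' v u v' u' : wprod a v / wprod b u = wprod a v' / wprod b u' ->
    wprod b u / wprod a v = wprod b u' / wprod a v'.
  by move=> e; rewrite -[LHS]invf_div e invf_div.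
have hN v u v' u' : wprod a v / wprod b u = wprod a v' / wprod b u' ->
    wdeg N v - (D * size u)%:Z = wdeg N v' - (D * size u')%:Z.
  move/hN1/(congr1 ( *%R^~ D2%:Z)); rewrite !mulrBl !wN.
  by rewrite /D -!PoszM !(mulnAC D1 D2).
have hM v u v' u' : wprod a v / wprod b u = wprod a v' / wprod b u' ->
    wdeg M u - (D * size v)%:Z = wdeg M u' - (D * size v')%:Z.
  move/inv'/hM2/(congr1 ( *%R^~ D1%:Z)); rewrite !mulrBl !wM.
  by rewrite /D -!PoszM !(mulnC D1 D2) !(mulnAC D2 D1).
have le_ab t x z : 0 < x -> 0 < z ->
    \sum_i (b i ^+ t * z ^+ D * x ^ M i) < 1 -> \sum_j (a j ^+ t * x ^+ D * z ^ N j) <= 1.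
  move=> x0 z0; apply: transfer_weight_le tab x0 z0 => // v u v' u' /hM e.
  by rewrite -[LHS]opprB e opprB.
have le_ba t x z : 0 < x -> 0 < z ->
    \sum_j (a j ^+ t * x ^+ D * z ^ N j) < 1 -> \sum_i (b i ^+ t * z ^+ D * x ^ M i) <= 1.
  move=> x0 z0; apply: transfer_weight_le tba z0 x0 => // v u v' u' /inv; first exact: hM.
  by move=> /hN e; rewrite -[LHS]opprB e opprB.
have M0 : forall i, 0 < M i.
  apply: (@unit_sum_degree_gt0 R m n D M D0 n1) => x x0 h.
  have := le_ba 0%N x 1 x0 ltr01; under eq_bigr do rewrite exp1rz mulr1 expr0 mul1r.
  by under [X in X <= _]eq_bigr do rewrite expr0 expr1n !mul1r; exact.
have N0 : forall j, 0 < N j.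
  apply: (@unit_sum_degree_gt0 R n m D N D0 m1) => z z0 h.
  have := le_ab 0%N 1 z ltr01 z0; under eq_bigr do rewrite exp1rz mulr1 expr0 mul1r.
  by under [X in X <= _]eq_bigr do rewrite expr0 expr1n !mul1r; exact.
pose N' j := `|N j|%N; pose M' i := `|M i|%N.
have NE j (z : R) : z ^ N j = z ^+ N' j by rewrite -[N j]gez0_abs ?ltW.
have ME i (x : R) : x ^ M i = x ^+ M' i by rewrite -[M i]gez0_abs ?ltW.
have level t (x z : R) : 0 < x -> 0 < z -> x ^+ D * \sum_j a j ^+ t * z ^+ N' j = 1 ->
    z ^+ D * \sum_i b i ^+ t * x ^+ M' i = 1.
  have PE (x' z' : R) : \sum_j (a j ^+ t * x' ^+ D * z' ^ N j) =
      x' ^+ D * \sum_j a j ^+ t * z' ^+ N' j.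
    by rewrite big_distrr; apply: eq_bigr => j _; rewrite NE /=; ring.
  have QE (x' z' : R) : \sum_i (b i ^+ t * z' ^+ D * x' ^ M i) =
      z' ^+ D * \sum_i b i ^+ t * x' ^+ M' i.
    by rewrite big_distrr; apply: eq_bigr => j _; rewrite ME /=; ring.
  apply: (same_unit_level D0) => [i|x' z' x0 z0|x' z' x0 z0].
  - by rewrite exprn_ge0//; have /andP[/ltW] := b01 i.
  - by rewrite -PE -QE; exact: le_ab.
  - by rewrite -PE -QE; exact: le_ba.
have i0 : 'I_n := Ordinal (ltnW n1); have j0 : 'I_m := Ordinal (ltnW m1).
have N'c : forall j j', N' j = N' j'.
  apply: (@level_exponents_constant R m n D N' M' D0 _ _ i0) => [i|x z x0 z0].
    by rewrite absz_gt0 gt_eqF.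
  have drop0 k (c : 'I_k -> R) (F : 'I_k -> R) : \sum_i c i ^+ 0 * F i = \sum_i F i.
    by apply: eq_bigr => i _; rewrite expr0 mul1r.
  by have := level 0%N x z x0 z0; rewrite !drop0.
exists D, (N' j0); split=> // [|t]; first by rewrite absz_gt0 gt_eqF.
have Pt0 : 0 < \sum_j a j ^+ t.
  rewrite (bigD1 j0)//= ltr_pwDl ?exprn_gt0//; first by have /andP[] := a01 j0.
  by apply: sumr_ge0 => j _; rewrite exprn_ge0//; have /andP[/ltW] := a01 j.
have N'0 : (0 < N' j0)%N by rewrite absz_gt0 gt_eqF.
have [z z0 zE] : exists2 z, 0 < z & z ^+ N' j0 = (\sum_j a j ^+ t)^-1.
  by apply: nat_root => //; rewrite invr_gt0.
have := level t 1 z ltr01 z0; rewrite expr1n mul1r.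
under eq_bigr do rewrite (N'c _ j0) zE; rewrite -big_distrl /= mulfV ?gt_eqF// => /(_ erefl).
under eq_bigr do rewrite expr1n mulr1.
move=> e.
have -> : \sum_i b i ^+ t = (z ^+ D)^-1.
  by apply: (mulfI (lt0r_neq0 (exprn_gt0 D z0))); rewrite e mulfV ?gt_eqF ?exprn_gt0.
by rewrite exprVn exprAC zE exprVn invrK.
Qed.

(** * Symbolic coding of dust-like sets *)

Section Enorm.
Variables (R : realType) (d : nat).
Implicit Types x y : 'rV[R]_d.

Lemma enorm_ge0 x : 0 <= enorm x.
Proof. exact: sqrtr_ge0. Qed.

Lemma enorm0 : enorm (0 : 'rV[R]_d) = 0.
Proof. by rewrite /enorm big1 ?sqrtr0// => i _; rewrite mxE expr0n. Qed.

Lemma enorm_coord x i : `|x 0 i| <= enorm x.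
Proof.
rewrite -sqrtr_sqr ler_wsqrtr// (bigD1 i)//= lerDl.
by apply: sumr_ge0 => j _; exact: sqr_ge0.
Qed.

Lemma enorm_eq0 x : enorm x = 0 -> x = 0.
Proof.
move=> x0; apply/rowP => i; rewrite mxE; apply/eqP.
by rewrite -normr_le0 -x0 enorm_coord.
Qed.

Lemma norm_le_enorm x : `|x| <= enorm x.
Proof.
rewrite [`|x|]mx_normrE; apply: bigmax_le => [|[i j] _ /=]; first exact: enorm_ge0.
by rewrite ord1 enorm_coord.
Qed.

(** Lets the compactness theorems, stated for the topology of the sup norm, apply to
Euclidean distances. *)
Lemma enorm_continuous : continuous (@enorm R d).
Proof.
move=> x; apply: continuous_comp; last exact: sqrt_continuous.
have FF : Filter (nbhs x) := nbhs_filter x.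
have addc : continuous (fun p : R * R => p.1 + p.2) by exact: add_continuous.
apply: (cvg_big addc FF) => i _.
apply: (@continuous_comp _ _ _ (fun y : 'rV[R]_d => y 0 i) (fun r : R => r ^+ 2)).
  exact: coord_continuous.
exact: exprn_continuous.
Qed.

Lemma similarity_continuous r (phi : 'rV[R]_d -> 'rV[R]_d) :
  similarity r phi -> continuous phi.
Proof.
move=> sim x; have FF : Filter (nbhs x) := nbhs_filter x.
apply/(@cvgrPdist_lt _ _ _ _ FF) => e e0.
have h : (fun y => r * enorm (x - y)) y @[y --> nbhs x] --> r * enorm (x - x).
  apply: (@continuous_comp _ _ _ (fun y : 'rV[R]_d => x - y) (fun y => r * enorm y)).
    by apply: continuousB; [exact: cst_continuous | exact: cvg_id].
  by apply: continuousM; [exact: cst_continuous | exact: enorm_continuous].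
rewrite subrr enorm0 mulr0 in h.
move/(@cvgrPdist_lt _ _ _ _ FF) : h => /(_ _ e0); apply: (@filterS _ _ FF) => y.
rewrite sub0r normrN => h; apply: le_lt_trans (norm_le_enorm _) _.
by rewrite sim; apply: le_lt_trans h; exact: ler_norm.
Qed.

Lemma enorm_dist_continuous :
  continuous (fun p : 'rV[R]_d * 'rV[R]_d => enorm (p.1 - p.2)).
Proof.
move=> p; apply: continuous_comp; last exact: enorm_continuous.
by apply: cvgB; [exact: cvg_fst | exact: cvg_snd].
Qed.

Lemma compact_enorm_bounded (E : set 'rV[R]_d) : compact E ->
  exists2 B, 0 < B & forall x y, E x -> E y -> enorm (x - y) <= B.
Proof.
move=> cE; have [[x0 Ex0]|none] := pselect (E !=set0); last first.
  by exists 1 => // x y Ex; exfalso; apply: none; exists x.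
have [|||[p1 p2] _ hp] :=
  @compact_EVT_max _ R (fun p : 'rV[R]_d * 'rV[R]_d => enorm (p.1 - p.2)) (E `*` E).
- by exists (x0, x0).
- exact: compact_setX.
- by apply: continuous_subspaceT; exact: enorm_dist_continuous.
exists (enorm (p1 - p2) + 1); first by rewrite ltr_wpDl ?enorm_ge0.
by move=> x y Ex Ey; rewrite -[leLHS]addr0 lerD// (hp (x, y))// inE.
Qed.

(** The distance attains its minimum on the compact product, and it vanishes only on the
diagonal. *)
Lemma compact_enorm_separated (A B : set 'rV[R]_d) : compact A -> compact B ->
  A `&` B = set0 -> exists2 c, 0 < c & forall x y, A x -> B y -> c <= enorm (x - y).
Proof.
move=> cA cB AB.
have [[[x0 y0] [/= Ax0 By0]]|none] := pselect (A `*` B !=set0); last first.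
  by exists 1 => // x y Ax By; exfalso; apply: none; exists (x, y).
have [|||[p1 p2]] :=
  @compact_EVT_min _ R (fun p : 'rV[R]_d * 'rV[R]_d => enorm (p.1 - p.2)) (A `*` B).
- by exists (x0, y0).
- exact: compact_setX.
- by apply: continuous_subspaceT; exact: enorm_dist_continuous.
rewrite inE => -[/= Ap1 Bp2] hp; exists (enorm (p1 - p2)); last first.
  by move=> x y Ax By; rewrite (hp (x, y))// inE.
rewrite lt_neqAle enorm_ge0 andbT; apply/eqP => /esym/enorm_eq0/eqP.
by rewrite subr_eq0 => /eqP e; rewrite -[False]/(set0 p1) -AB; split=> //; rewrite e.
Qed.

End Enorm.

(** A surjection from addresses whose distances are prefix products up to constants. The lower
bound makes it injective ([coding_inj]). *)
Definition coding (R : realType) (d m : nat) (a : 'I_m -> R) (E : set 'rV[R]_d)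
    (pi : address m -> 'rV[R]_d) (c B : R) : Prop :=
  [/\ 0 < c, 0 < B, pi @` setT = E & forall x y k, split_at x y k ->
    c * wprod a (mkseq x k) <= enorm (pi x - pi y) <= B * wprod a (mkseq x k)].

Section Coding.
Variables (R : realType) (d m : nat) (a : 'I_m -> R).
Variables (phi : 'I_m -> 'rV[R]_d -> 'rV[R]_d) (E : set 'rV[R]_d).
Hypothesis a01 : forall j, 0 < a j < 1.
Hypothesis sim : forall j, similarity (a j) (phi j).
Hypothesis att : is_attractor phi E.
Hypothesis dust : trivIset [set: 'I_m] (fun j => phi j @` E).

Definition phi_word (w : seq 'I_m) (p : 'rV[R]_d) : 'rV[R]_d := foldr phi p w.

Lemma phi_word_sim w : similarity (wprod a w) (phi_word w).
Proof.
by elim: w => [|j w IH] p q; rewrite ?wprod_nil ?mul1r//= sim IH wprod_cons mulrA.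
Qed.

Lemma phi_word_mem w p : E p -> E (phi_word w p).
Proof.
move=> Ep; elim: w => [//|j w IH] /=; have [_ _ ->] := att.
by exists j => //; exists (phi_word w p).
Qed.

Lemma phi_word_cat u v p : phi_word (u ++ v) p = phi_word u (phi_word v p).
Proof. by rewrite /phi_word foldr_cat. Qed.

Let piece w := phi_word w @` E.

Let piece_cat u v : piece (u ++ v) `<=` piece u.
Proof.
move=> _ [p Ep <-]; rewrite phi_word_cat; exists (phi_word v p) => //.
exact: phi_word_mem.
Qed.

Let piece_compact w : compact (piece w).
Proof.
have [_ cE _] := att; apply: continuous_compact => //.
apply: continuous_subspaceT; exact: similarity_continuous (phi_word_sim w).
Qed.

(** The nested compact pieces along an address share a cluster point of the orbit of a base
point. *)
Lemma address_point (x : address m) : exists p, forall k, piece (mkseq x k) p.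
Proof.
have [[e Ee] cE _] := att.
pose q k := phi_word (mkseq x k) e.
have qE k : E (q k) by exact: phi_word_mem.
have qk k l : (k <= l)%N -> piece (mkseq x k) (q l).
  move=> kl; have := @piece_cat (mkseq x k) (drop k (mkseq x l)) (q l).
  rewrite -(take_mkseq x kl) cat_take_drop; apply; exists e => //.
have [p [_ cp]] := cE (q @ \oo) _ (@filterE _ \oo _ (fun k => E (q k)) qE).
have cl k : closed (piece (mkseq x k)).
  by apply: compact_closed; [exact: norm_hausdorff | exact: piece_compact].
exists p => k; apply: cl => V Vp; apply: cp => //.
by exists k => // l /= kl; exact: qk.
Qed.

Lemma exists_digit p : E p -> exists jq, E jq.2 /\ p = phi jq.1 jq.2.
Proof. by have [_ _ {1}->] := att; move=> [j _ [q Eq <-]]; exists (j, q). Qed.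

(** The digits of [p] are read off by repeatedly pulling it back through the
map whose image contains it. *)
Lemma point_address p : E p -> exists x : address m, forall k, piece (mkseq x k) p.
Proof.
move=> Ep.
have /choice[f hf] : forall q, exists jq, E q -> E jq.2 /\ q = phi jq.1 jq.2.
  move=> q; have [Eq|nEq] := pselect (E q).
    by have [jq ?] := exists_digit Eq; exists jq.
  by have [jq _] := exists_digit Ep; exists jq => /nEq.
pose orb k := iter k (fun q => (f q).2) p; pose x k := (f (orb k)).1.
have orbE k : E (orb k) by elim: k => [//|k IH] /=; have [] := hf _ IH.
exists x => k; exists (orb k) => //; elim: k => [//|k IH].
rewrite mkseqS -cats1 phi_word_cat /= -[RHS]IH; congr phi_word.
by have [_] := hf _ (orbE k).
Qed.

(** Two points whose addresses first differ at [k] are images, under the similarity of the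
common prefix, of points of two distinct first-level pieces: these are a bounded and a
positive distance apart. *)
Lemma dustlike_coding : exists pi c B, coding a E pi c B.
Proof.
have [_ cE _] := att.
have [B B0 hB] := compact_enorm_bounded cE.
have /choice[pi piP] := address_point.
have piece_sep j : exists c, 0 < c /\ forall i, i != j -> forall p q,
    (phi i @` E) p -> (phi j @` E) q -> c <= enorm (p - q).
  have /choice[c hc] : forall i, exists c, 0 < c /\ (i != j -> forall p q,
      (phi i @` E) p -> (phi j @` E) q -> c <= enorm (p - q)).
    move=> i; have [ij|ij] := eqVneq i j; first by exists 1; split=> // /eqP.
    have [|c c0 h] :=
      @compact_enorm_separated _ _ _ _ (@piece_compact [:: i]) (@piece_compact [:: j]).
    - apply: contrapT => /eqP/set0P ne; apply/negP: ij; rewrite negbK; apply/eqP.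
      by apply: dust.
    - by exists c; split=> // _ p q Ap Bq; exact: h.
  exists (\big[Order.min/1]_i c i); split=> [|i ij p q Ap Bq].
    by apply/bigmin_gtP; split=> // i _; have [] := hc i.
  have [_ h] := hc i; apply: le_trans (h ij _ _ Ap Bq); exact: bigmin_le_cond.
have /choice[c hc] := piece_sep.
pose c0 := \big[Order.min/1]_i c i.
exists pi, c0, B; split=> //.
- by apply/bigmin_gtP; split=> // i _; have [] := hc i.
- apply/seteqP; split=> [_ [x _ <-]|p Ep]; first by have [q Eq <-] := piP x 0%N.
  have [x hx] := point_address Ep; exists x => //.
  apply/eqP; rewrite -subr_eq0; apply/eqP/enorm_eq0/eqP; rewrite eq_le enorm_ge0 andbT.
  rewrite leNgt; apply/negP => e0.
  have [k hk] := wprod_small a01 (divr_gt0 e0 B0).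
  have [[q Eq qE] [r Er rE]] := (piP x k, hx k).
  have := hk (mkseq x k); rewrite size_mkseq leqnn => /(_ isT).
  rewrite ltr_pdivlMr// -qE -rE phi_word_sim ltr_pM2l ?wprod_gt0// ltNge.
  by rewrite hB.
- move=> x y k [exy nxy]; apply/andP; split.
    have [q Eq qE] := piP x k.+1; have [r Er rE] := piP y k.+1.
    move: qE rE; rewrite !mkseqS -!cats1 !phi_word_cat /= => <- <-.
    rewrite exy phi_word_sim mulrC.
    rewrite ler_pM2l ?wprod_gt0//; have [_ h] := hc (y k).
    apply: le_trans (h (x k) _ _ _ _ _); last 3 first.
    + exact/eqP.
    + by exists q.
    + by exists r.
    exact: bigmin_le_cond.
  have [q Eq <-] := piP x k; have := piP y k; rewrite -exy => -[r Er <-].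
  by rewrite phi_word_sim mulrC ler_pM2r ?wprod_gt0// hB.
Qed.

End Coding.

(** * Lipschitz equivalence in terms of addresses *)

Lemma coding_inj (R : realType) (d m : nat) (a : 'I_m -> R) (E : set 'rV[R]_d) pi c B :
  (forall i, 0 < a i < 1) -> coding a E pi c B -> injective pi.
Proof.
move=> a01 [c0 _ _ h] x y exy; apply: contrapT => /neq_split[k sk].
have /andP[+ _] := h _ _ _ sk; apply/negP; rewrite -ltNge exy subrr enorm0.
by rewrite mulr_gt0// wprod_gt0.
Qed.

Section Addresses.
Variables (R : realType) (d m n : nat) (a : 'I_m -> R) (b : 'I_n -> R).
Hypothesis (a01 : forall i, 0 < a i < 1) (b01 : forall i, 0 < b i < 1).

Lemma comparable_addresses_inv (C : R) (g : address m -> address n) g' :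
  cancel g' g -> comparable_addresses a b C g -> comparable_addresses b a C g'.
Proof.
by move=> gK' h x y k l sk sl; have := h _ _ l k sl; rewrite !gK' => /(_ sk)[].
Qed.

Variables (E F : set 'rV[R]_d) (pi : address m -> 'rV[R]_d) (pi' : address n -> 'rV[R]_d).
Variables (c B c' B' : R).
Hypothesis (piE : coding a E pi c B) (piF : coding b F pi' c' B').

(** Conjugates the Lipschitz equivalence by the two codings. *)
Lemma lipschitz_addresses : lipschitz_equiv E F ->
  exists (g : address m -> address n) (g' : address n -> address m) (C : R),
    [/\ cancel g g', cancel g' g, 1 <= C & comparable_addresses a b C g].
Proof.
move=> [f [K [K0 [fEF finj fsurj] fK]]].
have pinj := coding_inj a01 piE; have pinj' := coding_inj b01 piF.
have [c0 B0 pE hE] := piE; have [c'0 B'0 pF hF] := piF.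
have Epi x : E (pi x) by rewrite -pE; exists x.
have /choice[g hg] : forall x, exists y, pi' y = f (pi x).
  by move=> x; have : F (f (pi x)) := fEF _ (Epi x); rewrite -pF => -[y _ <-]; exists y.
have /choice[g' hg'] : forall y, exists x, f (pi x) = pi' y.
  move=> y; have /fsurj[p Ep <-] : F (pi' y) by rewrite -pF; exists y.
  by move: Ep; rewrite -pE => -[x _ <-]; exists x.
pose C := Num.max 1 (Num.max (K * B' / c) (K * B / c')).
exists g, g', C; split.
- by move=> x; apply/pinj/finj; rewrite ?inE// hg' hg.
- by move=> y; apply: pinj'; rewrite hg hg'.
- by rewrite /C le_max lexx.
move=> x y k l sk sl.
have /andP[h1 h2] := hE _ _ _ sk; have /andP[h3 h4] := hF _ _ _ sl.
have /andP[h5 h6] := fK _ _ (Epi x) (Epi y); rewrite -!hg in h5 h6.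
split.
- apply: le_trans (_ : K * B' / c * wprod b (mkseq (g x) l) <= _); last first.
    by rewrite ler_pM2r ?wprod_gt0// /C !le_max lexx !orbT.
  rewrite mulrAC ler_pdivlMr// mulrC; apply: le_trans h1 _.
  rewrite mulrC ler_pdivrMr// in h5; apply: le_trans h5 _.
  by rewrite mulrC -mulrA ler_pM2l.
- apply: le_trans (_ : K * B / c' * wprod a (mkseq x k) <= _); last first.
    by rewrite ler_pM2r ?wprod_gt0// /C !le_max lexx !orbT.
  rewrite mulrAC ler_pdivlMr// mulrC; apply: le_trans h3 _.
  by apply: le_trans h6 _; rewrite -mulrA ler_pM2l.
Qed.

Lemma addresses_lipschitz (i0 : 'I_m) (g : address m -> address n) g' C :
  cancel g g' -> cancel g' g -> 0 < C -> comparable_addresses a b C g ->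
  lipschitz_equiv E F.
Proof.
move=> gK gK' C0 gC.
have pinj := coding_inj a01 piE; have pinj' := coding_inj b01 piF.
have [c0 B0 pE hE] := piE; have [c'0 B'0 pF hF] := piF.
have /choice[cd hcd] : forall p, exists x, E p -> pi x = p.
  move=> p; have [|nEp] := pselect (E p); last by exists (fun=> i0).
  by rewrite -{1}pE => -[x _ <-]; exists x.
pose f p := pi' (g (cd p)).
pose K := Num.max (C * B' / c) (C * B / c').
have K0 : 0 < K by rewrite lt_max !divr_gt0 ?mulr_gt0.
exists f, K; split=> //.
- split.
  + by move=> p Ep; rewrite -pF; exists (g (cd p)).
  + move=> p q; rewrite !inE => Ep Eq /pinj' /(can_inj gK) e.
    by rewrite -(hcd _ Ep) -(hcd _ Eq) e.
  + move=> q; rewrite -pF => -[y _ <-]; exists (pi (g' y)); first by rewrite -pE; exists (g' y).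
    rewrite /f (_ : cd _ = g' y) ?gK'//; apply: pinj; apply: hcd.
    by rewrite -pE; exists (g' y).
move=> p q Ep Eq; have [->|pq] := eqVneq p q; first by rewrite !subrr !enorm0 !mulr0 lexx.
have [k sk] : exists k, split_at (cd p) (cd q) k.
  by apply: neq_split => e; move/eqP: pq; apply; rewrite -(hcd _ Ep) -(hcd _ Eq) e.
have [l sl] : exists l, split_at (g (cd p)) (g (cd q)) l.
  by apply: neq_split => /(can_inj gK); exact: split_neq sk.
have /andP[h1 h2] := hE _ _ _ sk; have /andP[h3 h4] := hF _ _ _ sl.
have [h5 h6] := gC _ _ _ _ sk sl.
rewrite !hcd// in h1 h2; apply/andP; split.
- rewrite mulrC ler_pdivrMr//; apply: le_trans h2 _.
  apply: le_trans (_ : C * B / c' * enorm (f p - f q) <= _); last first.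
    by rewrite mulrC ler_wpM2l ?enorm_ge0// /K le_max lexx orbT.
  have h7 : wprod b (mkseq (g (cd p)) l) <= enorm (f p - f q) / c'.
    by rewrite ler_pdivlMr// mulrC.
  have -> : C * B / c' * enorm (f p - f q) = B * (C * (enorm (f p - f q) / c')) by ring.
  by rewrite ler_pM2l//; apply: le_trans h5 _; rewrite ler_pM2l.
- apply: le_trans h4 _; apply: le_trans (_ : C * B' / c * enorm (p - q) <= _); last first.
    by rewrite ler_wpM2r ?enorm_ge0// /K le_max lexx.
  have h7 : wprod a (mkseq (cd p) k) <= enorm (p - q) / c.
    by rewrite ler_pdivlMr// mulrC.
  have -> : C * B' / c * enorm (p - q) = B' * (C * (enorm (p - q) / c)) by ring.
  by rewrite ler_pM2l//; apply: le_trans h6 _; rewrite ler_pM2l.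
Qed.

End Addresses.

(** * Blockwise recoding *)

Lemma perm_map_bij (T1 T2 V : eqType) (d1 : T1) (d2 : T2) (s1 : seq T1) (s2 : seq T2)
    (f1 : T1 -> V) (f2 : T2 -> V) :
  uniq s1 -> uniq s2 -> perm_eq (map f1 s1) (map f2 s2) ->
  exists (h : T1 -> T2) (h' : T2 -> T1),
    (forall w, w \in s1 -> [/\ h w \in s2, f2 (h w) = f1 w & h' (h w) = w]) /\
    (forall u, u \in s2 -> h' u \in s1 /\ h (h' u) = u).
Proof.
elim: s1 s2 => [|x s1 IH] s2 /=.
  move=> _ _ /perm_size; rewrite size_map => /esym/size0nil ->.
  by exists (fun=> d2), (fun=> d1).
move=> /andP[xs1 us1] us2 pe.
have /mapP[y ys2 fxy] : f1 x \in map f2 s2 by rewrite -(perm_mem pe) mem_head.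
have pe2 := perm_to_rem ys2.
have pe' : perm_eq (map f1 s1) (map f2 (rem y s2)).
  by rewrite -(perm_cons (f1 x)) (perm_trans pe)// fxy -map_cons perm_map.
have [h [h' [hh hh']]] := IH _ us1 (rem_uniq y us2) pe'.
have memr u : u \in rem y s2 = (u != y) && (u \in s2) by exact: mem_rem_uniq.
exists (fun w => if w == x then y else h w), (fun u => if u == y then x else h' u).
split=> [w|u].
  rewrite inE; have [->|wx] /= := eqVneq w x; first by rewrite ys2 eqxx fxy.
  by move=> /hh[]; rewrite memr => /andP[/negbTE-> ->] -> ->.
have [->|uy us] := eqVneq u y; first by rewrite inE !eqxx.
have [|h's e] := hh' u; first by rewrite memr uy.
rewrite inE h's orbT; split=> //; case: eqP => // e'.
by move: xs1; rewrite -e' h's.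
Qed.

Definition block (m p : nat) (x : address m) (K : nat) : seq 'I_m :=
  mkseq (fun i => x (K * p + i)%N) p.

Definition block_map (m n p q : nat) (j0 : 'I_n) (h : seq 'I_m -> seq 'I_n)
    (x : address m) : address n :=
  fun l => nth j0 (h (block p x (l %/ q))) (l %% q).

Lemma block_words (m p : nat) (x : address m) K : block p x K \in words m p.
Proof. by rewrite -[X in words m X](size_mkseq (fun i => x (K * p + i)%N) p) mem_words. Qed.

Lemma mkseq_block (m p : nat) (x : address m) K :
  mkseq x (K.+1 * p) = mkseq x (K * p) ++ block p x K.
Proof.
rewrite /block /mkseq mulSn addnC iotaD map_cat; congr (_ ++ _).
by rewrite add0n -[in LHS](addn0 (K * p)%N) iotaDl -map_comp.
Qed.

(** Bounds from below what the letters of an incomplete block contribute. *)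
Lemma wprod_lower (R : realType) (m k : nat) (a : 'I_m -> R) (c : R) w :
  0 < c -> c <= 1 -> (forall i, c <= a i) -> (size w <= k)%N -> c ^+ k <= wprod a w.
Proof.
move=> c0 c1 ca sw; apply: (@le_trans _ _ (c ^+ size w)).
  by rewrite ler_wiXn2l// ltW.
elim: w {sw} => [|i w IH]; first by rewrite wprod_nil.
by rewrite wprod_cons exprS ler_pM// ?exprn_ge0// ltW.
Qed.

Section BlockMap.
Variables (m n p q : nat) (i0 : 'I_m) (j0 : 'I_n).
Variables (h : seq 'I_m -> seq 'I_n) (h' : seq 'I_n -> seq 'I_m).
Hypothesis (p0 : (0 < p)%N) (q0 : (0 < q)%N).
Hypothesis hw : forall w, w \in words m p -> h w \in words n q.

Let g := block_map p q j0 h.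

Lemma block_block_map x K : block q (g x) K = h (block p x K).
Proof.
have sz := size_words (hw (block_words p x K)).
apply: (@eq_from_nth _ j0); first by rewrite size_mkseq sz.
move=> i; rewrite size_mkseq => iq; rewrite nth_mkseq// /g /block_map.
by rewrite divnMDl// divn_small// addn0 modnMDl modn_small.
Qed.

Lemma block_map_agree x y K : mkseq x (K * p) = mkseq y (K * p) ->
  mkseq (g x) (K * q) = mkseq (g y) (K * q).
Proof.
elim: K => [//|K IH] e; rewrite !mkseq_block !block_block_map.
move/eqP: e; rewrite !mkseq_block eqseq_cat ?size_mkseq// => /andP[/eqP e1 /eqP ->].
by rewrite IH.
Qed.

Hypothesis hK : forall w, w \in words m p -> h' (h w) = w.

Lemma block_mapK : cancel g (block_map q p i0 h').
Proof.
move=> x; apply/funext => l; rewrite {1}/block_map block_block_map hK ?block_words//.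
by rewrite /block nth_mkseq ?ltn_pmod// -divn_eq.
Qed.

End BlockMap.

Section Comparable.
Variables (R : realType) (m n p q : nat) (a : 'I_m -> R) (b : 'I_n -> R).
Variables (i0 : 'I_m) (j0 : 'I_n).
Hypothesis (a01 : forall i, 0 < a i < 1) (b01 : forall i, 0 < b i < 1).
Hypothesis (p0 : (0 < p)%N) (q0 : (0 < q)%N).

(** Prefix products of an address and of its recoding agree at the ends of blocks, and two
addresses and their recodings first differ in blocks of the same index. Inside a block
products vary by a bounded factor. *)
Lemma iterates_comparable :
  perm_eq (map (wprod a) (words m p)) (map (wprod b) (words n q)) ->
  exists (g : address m -> address n) g' C,
    [/\ cancel g g', cancel g' g, 0 < C & comparable_addresses a b C g].
Proof.
move=> /(perm_map_bij [::] [::] (uniq_words m p) (uniq_words n q)).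
move=> [h [h' [hh hh']]].
have hw w : w \in words m p -> h w \in words n q by move=> /hh[].
have h'w u : u \in words n q -> h' u \in words m p by move=> /hh'[].
have hK w : w \in words m p -> h' (h w) = w by move=> /hh[].
have hK' u : u \in words n q -> h (h' u) = u by move=> /hh'[].
pose g := block_map p q j0 h; pose g' := block_map q p i0 h'.
have gK : cancel g g' by exact: block_mapK.
have gK' : cancel g' g by exact: block_mapK.
have [ca ca0 hca] := exists_min a01; have [cb cb0 hcb] := exists_min b01.
have ca1 : ca <= 1 by apply: le_trans (hca i0) _; have /andP[_ /ltW] := a01 i0.
have cb1 : cb <= 1 by apply: le_trans (hcb j0) _; have /andP[_ /ltW] := b01 j0.
pose C := Num.max (ca ^+ p)^-1 (cb ^+ q)^-1.
have C0 : 0 < C by rewrite lt_max invr_gt0 exprn_gt0.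
exists g, g', C; split=> // x y k l sk sl.
have prodE K : wprod a (mkseq x (K * p)) = wprod b (mkseq (g x) (K * q)).
  elim: K => [|K IH]; first by rewrite !wprod_nil.
  rewrite !mkseq_block !wprod_cat IH; congr (_ * _).
  by rewrite block_block_map//; have [_ ->] := hh _ (block_words p x K).
have split_block r (z z' : address r) e s : (0 < s)%N -> split_at z z' e ->
    mkseq z (e %/ s * s) = mkseq z' (e %/ s * s).
  move=> s0 [e1 _]; have le := leq_trunc_div e s.
  by rewrite -(take_mkseq z le) e1 take_mkseq.
have eK : (k %/ p)%N = (l %/ q)%N.
  apply/eqP; rewrite eqn_leq !leq_divRL//; apply/andP; split.
    exact/(split_lt sl)/block_map_agree/split_block.
  apply: (split_lt sk); rewrite -(gK x) -(gK y).
  exact/block_map_agree/split_block.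
have lower r s e (c : R) (f : 'I_r -> R) (z : address r) : (0 < s)%N ->
    0 < c -> c <= 1 -> (forall i, c <= f i) -> (forall i, 0 < f i < 1) ->
    wprod f (mkseq z (e %/ s * s)) <= (c ^+ s)^-1 * wprod f (mkseq z e).
  move=> s0 c0 c1 hc f01; have le := leq_trunc_div e s.
  rewrite mulrC ler_pdivlMr ?exprn_gt0//.
  rewrite -(cat_take_drop (e %/ s * s) (mkseq z e)) take_mkseq// wprod_cat.
  rewrite ler_pM2l ?wprod_gt0//; apply: wprod_lower => //.
  by rewrite size_drop size_mkseq leq_subLR {1}(divn_eq e s) leq_add2l ltnW// ltn_pmod.
have ax : wprod a (mkseq x k) <= wprod a (mkseq x (k %/ p * p)).
  by apply: wprod_mkseq => //; exact: leq_trunc_div.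
have bx : wprod b (mkseq (g x) l) <= wprod b (mkseq (g x) (l %/ q * q)).
  by apply: wprod_mkseq => //; exact: leq_trunc_div.
split.
- apply: le_trans ax _; rewrite prodE eK.
  apply: le_trans (lower _ _ _ _ _ _ q0 cb0 cb1 hcb b01) _.
  by rewrite ler_pM2r ?wprod_gt0// /C le_max lexx orbT.
- apply: le_trans bx _; rewrite -eK -prodE.
  apply: le_trans (lower _ _ _ _ _ _ p0 ca0 ca1 hca a01) _.
  by rewrite ler_pM2r ?wprod_gt0// /C le_max lexx.
Qed.

End Comparable.

(** * Coplanarity and word length *)

Section Exponents.
Variables (R : realType) (s : nat) (lambda : s.-tuple R).
Hypothesis l0 : forall i, 0 < tnth lambda i.
Implicit Types x y : 'rV[int]_s.

Lemma mul_exp0 : mul_exp lambda 0 = 1.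
Proof. by rewrite /mul_exp big1// => i _; rewrite mxE expr0z. Qed.

Lemma mul_expD x y : mul_exp lambda (x + y) = mul_exp lambda x * mul_exp lambda y.
Proof.
rewrite /mul_exp -big_split; apply: eq_bigr => i _ /=.
by rewrite mxE expfzDr// gt_eqF.
Qed.

Lemma mul_expZ k x : mul_exp lambda (k *: x) = mul_exp lambda x ^ k.
Proof.
rewrite /mul_exp (big_morph (fun r : R => r ^ k) (fun u v => expfzMl u v k) (exp1rz _ k)).
by apply: eq_bigr => i _; rewrite mxE mulrC exprz_exp.
Qed.

Lemma mul_exp_gt0 x : 0 < mul_exp lambda x.
Proof. by apply: prodr_gt0 => i _; exact: exprz_gt0. Qed.

Lemma mul_expN x : mul_exp lambda (- x) = (mul_exp lambda x)^-1.
Proof. by rewrite -scaleN1r mul_expZ exprN1. Qed.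

Lemma mul_exp_mulmx (b : s.-tuple R) (B : 'M[int]_s) y :
  (forall i, mul_exp lambda (row i B) = tnth b i) ->
  mul_exp lambda (y *m B) = mul_exp b y.
Proof.
move=> hB; rewrite mulmx_sum_row (big_morph _ mul_expD mul_exp0).
by apply: eq_bigr => i _; rewrite mul_expZ hB.
Qed.

(** The elements with an exponent vector form a group containing the generators. *)
Lemma gen_group_exp r : gen_group lambda r -> exists x, mul_exp lambda x = r.
Proof.
apply: (_ : smallest (@pos_subgroup R) _ `<=` [set r | exists x, mul_exp lambda x = r]).
apply: smallest_sub.
  split=> [_ [x <-]||_ _ [x <-] [y <-]|_ [x <-]].
  - exact: mul_exp_gt0.
  - by exists 0; exact: mul_exp0.
  - by exists (x + y); rewrite mul_expD.
  - by exists (- x); rewrite mul_expN.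
move=> _ /= /tnthP[i ->]; exists (delta_mx 0 i).
rewrite /mul_exp (bigD1 i)//= big1 ?mulr1; first by rewrite mxE !eqxx expr1z.
by move=> j ji; rewrite mxE (negbTE ji) andbF expr0z.
Qed.

End Exponents.

Lemma gen_group_mem (R : realType) (m : nat) (rho : m.-tuple R) j :
  gen_group rho (tnth rho j).
Proof. by move=> A [_]; apply; exact: mem_tnth. Qed.

(** The exponents [B] of a basis of the group of [rho] form a nonsingular square matrix, because
a left kernel vector would be a relation in the basis. Hence [lambda] is independent and
[log_vec] is additive, so the linear form [ev] of the hyperplane takes the value [c] times
the length on the exponent vector of a word. The constant [c] is not 0: otherwise [ev] would
vanish on all rows of [B]. *)
Lemma coplanar_homogeneous (R : realType) (m : nat) (rho : m.-tuple R) :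
  (forall j, 0 < tnth rho j) -> coplanar rho -> homogeneous (tnth rho).
Proof.
move=> r0 [s [lambda [P [[l0 sub [b [b0 genb indb]]] [al [c [al0 ->]]] hP]]]].
have genE i : gen_group rho (tnth b i) by rewrite -genb; exact: gen_group_mem.
have /choice[e he] : forall i, exists x, mul_exp lambda x = tnth b i.
  by move=> i; apply: gen_group_exp => //; apply: sub.
pose B : 'M[int]_s := \matrix_i e i.
have rowB i : mul_exp lambda (row i B) = tnth b i by rewrite rowK.
have detB : \det B != 0.
  apply/det0P => -[v v0 vB]; move/eqP: v0; apply; apply: indb.
  by rewrite -(mul_exp_mulmx l0 _ rowB) vB mul_exp0.
have indl x : mul_exp lambda x = 1 -> x = 0.
  move=> x1; have : x *m \adj B = 0.
    apply: indb; rewrite -(mul_exp_mulmx l0 _ rowB) -mulmxA mul_adj_mx.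
    by rewrite mul_mx_scalar mul_expZ// x1 exp1rz.
  move/(congr1 (mulmx^~ B)); rewrite -mulmxA mul_adj_mx mul0mx mul_mx_scalar => /eqP.
  by rewrite scalemx_eq0 (negbTE detB) /= => /eqP.
have injl x y : mul_exp lambda x = mul_exp lambda y -> x = y.
  move=> exy; apply/eqP; rewrite -subr_eq0; apply/eqP/indl.
  by rewrite mul_expD// mul_expN// exy mulfV// gt_eqF// mul_exp_gt0.
pose L j := log_vec lambda (tnth rho j).
have hL j : mul_exp lambda (L j) = tnth rho j.
  have [x hx] := gen_group_exp l0 (sub _ (@gen_group_mem _ _ rho j)).
  exact: (@xgetPex _ 0 [set x | mul_exp lambda x = tnth rho j] (ex_intro _ x hx)).
pose ev (x : 'rV[int]_s) : R := \sum_i al 0 i * (x 0 i)%:~R.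
have evD x y : ev (x + y) = ev x + ev y.
  rewrite /ev -big_split; apply: eq_bigr => i _ /=.
  by rewrite mxE rmorphD /= mulrDr.
have ev0 : ev 0 = 0 by rewrite /ev big1// => i _; rewrite mxE mulr0.
have evN x : ev (- x) = - ev x.
  by apply/eqP; rewrite -addr_eq0 -evD addNr ev0.
have evL j : ev (L j) = c.
  by have := hP j; rewrite /= => <-; apply: eq_bigr => i _; rewrite mxE.
have c0 : c != 0.
  apply: contraNneq al0 => cE; apply/eqP.
  have gen0 r : gen_group rho r -> exists2 x, mul_exp lambda x = r & ev x = 0.
    apply: (_ : smallest (@pos_subgroup R) _ `<=`
      [set r | exists2 x, mul_exp lambda x = r & ev x = 0]).
    apply: smallest_sub.
      split=> [_ [x <- _]||_ _ [x <- ex] [y <- ey]|_ [x <- ex]].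
      - exact: mul_exp_gt0.
      - by exists 0 => //; exact: mul_exp0.
      - by exists (x + y); rewrite ?mul_expD// evD ex ey addr0.
      - by exists (- x); rewrite ?mul_expN// evN ex oppr0.
    by move=> _ /= /tnthP[j ->]; exists (L j); rewrite // evL.
  have Bal : map_mx intr B *m al^T = 0 :> 'M[R]_(s, 1).
    apply/colP => i; rewrite !mxE.
    have [x hx ex] := gen0 _ (genE i).
    have xe : x = e i by apply: injl; rewrite hx he.
    rewrite -[RHS]ex xe /ev.
    by apply: eq_bigr => k _; rewrite !mxE mulrC.
  have detB' : \det (map_mx intr B : 'M[R]_s) != 0.
    by rewrite det_map_mx intr_eq0.
  have := congr1 (mulmx (\adj (map_mx intr B))) Bal.
  rewrite mulmxA mul_adj_mx mulmx0 mul_scalar_mx => /eqP.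
  by rewrite scalemx_eq0 (negbTE detB') /= => /eqP/(congr1 trmx); rewrite trmxK trmx0.
pose X w := \sum_(j <- w) L j.
have hX w : mul_exp lambda (X w) = wprod (tnth rho) w.
  rewrite /X (big_morph _ (mul_expD l0) (mul_exp0 lambda)).
  by apply: eq_bigr => j _; exact: hL.
have evX w : ev (X w) = c *+ size w.
  rewrite /X (big_morph _ evD ev0); elim: w => [|j w IH]; first by rewrite big_nil.
  by rewrite big_cons IH evL -mulrS.
move=> w w' e'; have /(congr1 ev) : X w = X w' by apply: injl; rewrite !hX.
rewrite !evX => /eqP; rewrite -subr_eq0 -[c *+ size w]mulr_natr -[c *+ size w']mulr_natr.
by rewrite -mulrBr mulf_eq0 (negbTE c0) /= subr_eq0 eqr_nat => /eqP.
Qed.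

(** * The similarity dimension and the conclusion *)

(** The sum is continuous in the exponent, equal to [m > 1] at 0 and at most 1 for large
exponents. *)
Lemma exists_similarity_dimension (R : realType) (m : nat) (a : 'I_m -> R) :
  (1 < m)%N -> (forall i, 0 < a i < 1) -> exists2 s, 0 < s & \sum_i a i `^ s = 1.
Proof.
move=> m1 a01; have a0 i : 0 < a i by have /andP[] := a01 i.
pose f (s : R) := \sum_i a i `^ s.
have cf : continuous f.
  move=> s; have FF : Filter (nbhs s) := nbhs_filter s.
  have addc : continuous (fun p : R * R => p.1 + p.2) by exact: add_continuous.
  apply: (cvg_big addc FF) => i _.
  have -> : powR (a i) = fun s => expR (s * ln (a i)).
    by apply/funext => r; rewrite /powR gt_eqF.
  apply: (@continuous_comp _ _ _ (fun r : R => r * ln (a i)) (@expR R)).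
    by apply: continuousM; [exact: cvg_id | exact: cst_continuous].
  exact: continuous_expR.
have [c /andP[c0 c1] ac] := exists_max a01.
have m0 : 0 < m%:R :> R by rewrite ltr0n ltnW.
have c01 : 0 <= c < 1 by rewrite c0.
have mi0 : 0 < m%:R^-1 :> R by rewrite invr_gt0.
have [K hK] := pow_small c01 mi0.
have f0 : f 0 = m%:R.
  by rewrite /f (eq_bigr (fun=> 1)) ?sumr_const ?card_ord// => i _; rewrite powRr0.
have fK : f K%:R <= 1.
  apply: (@le_trans _ _ (\sum_(i < m) m%:R^-1)); last first.
    by rewrite sumr_const card_ord -[X in X <= _]mulr_natl mulfV ?gt_eqF.
  apply: ler_sum => i _; rewrite powR_mulrn ?(ltW (a0 i))//.
  apply: le_trans (ltW hK); apply: lerXn2r; rewrite ?nnegrE//; exact: ltW.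
have [|s] := @IVT R f 0 K%:R 1 (ler0n _ K) (continuous_subspaceT cf).
  rewrite f0 ge_min le_max fK orbT /=.
  by rewrite ler1n ltnW.
rewrite in_itv /= => /andP[s0 _] fs; exists s => //.
rewrite lt_neqAle s0 andbT; apply/eqP => s0'.
by move/eqP: fs; rewrite -s0' f0 pnatr_eq1 gtn_eqF.
Qed.

Lemma bilip_transfer_both (R : realType) (m n : nat) (a : 'I_m -> R) (b : 'I_n -> R)
    g g' (C : R) :
  (forall i, 0 < a i < 1) -> (forall i, 0 < b i < 1) -> (1 < m)%N -> (1 < n)%N ->
  cancel g g' -> cancel g' g -> 1 <= C -> comparable_addresses a b C g ->
  transfer a b /\ transfer b a.
Proof.
move=> a01 b01 m1 n1 gK gK' C1 gC.
have gC' := comparable_addresses_inv gK' gC.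
pose i0 : 'I_m := Ordinal (ltnW m1); pose j0 : 'I_n := Ordinal (ltnW n1).
have [s s0 sa] := exists_similarity_dimension m1 a01.
have [t t0 tb] := exists_similarity_dimension n1 b01.
have ts : t = s.
  apply/eqP; rewrite eq_le (bilip_exponent_le a01 b01 gK gK' C1 gC i0 t0 sa tb).
  by rewrite (bilip_exponent_le b01 a01 gK' gK C1 gC' j0 s0 tb sa).
split; first exact: (bilip_transfer a01 b01 gK gK' C1 gC i0 s0 t0 sa tb ts).
exact: (bilip_transfer b01 a01 gK' gK C1 gC' j0 t0 s0 tb sa (esym ts)).
Qed.

(** Over one letter there is only one address, over two or more there are several. *)
Lemma single_letter_address (n : nat) (g : address 1 -> address n) g' :
  cancel g' g -> ~ (1 < n)%N.
Proof.
move=> gK' n1; pose x (k : 'I_n) : address n := fun=> k.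
have : x (Ordinal (ltnW n1)) = x (Ordinal n1).
  by apply: (can_inj gK'); apply/funext => k; rewrite ord1 [RHS]ord1.
by move/(congr1 (fun y => val (y 0%N))).
Qed.

Lemma power_sum_iteration (R : realType) (m : nat) (rho : m.-tuple R) p t :
  \sum_(r <- iteration rho p) r ^+ t = (\sum_j tnth rho j ^+ t) ^+ p.
Proof.
rewrite big_map -sum_words; apply: eq_bigr => w _.
by rewrite /wprod prodrXl.
Qed.

Theorem theorem1p6 (R : realType) (d m n : nat)
    (rho : m.-tuple R) (tau : n.-tuple R)
    (hd : (0 < d)%N) (hmn : (1 < m)%N \/ (1 < n)%N)
    (hrho : contraction_vector d rho) (htau : contraction_vector d tau)
    (hDrho : exists E : set 'rV[R]_d, dustlike_sets rho E)
    (hDtau : exists F : set 'rV[R]_d, dustlike_sets tau F)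
    (crho : coplanar rho) (ctau : coplanar tau) :
  dustlike_equiv d rho tau <->
  exists p q : nat,
    [/\ (1 <= p)%N, (1 <= q)%N & perm_eq (iteration rho p) (iteration tau q)].
Proof.
have [m0 a01 _] := hrho; have [n0 b01 _] := htau.
have i0 : 'I_m := Ordinal m0; have j0 : 'I_n := Ordinal n0.
split.
  move=> [E [F [[phi [simE attE dustE]] [psi [simF attF dustF]] EF]]].
  have [pi [c [B piE]]] := dustlike_coding a01 simE attE dustE.
  have [pi' [c' [B' piF]]] := dustlike_coding b01 simF attF dustF.
  have [g [g' [C [gK gK' C1 gC]]]] := lipschitz_addresses a01 b01 piE piF EF.
  have m1 : (1 < m)%N.
    rewrite ltn_neqAle m0 andbT; apply/eqP => m1; subst m.
    by case: hmn => //; exact: single_letter_address gK'.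
  have n1 : (1 < n)%N.
    rewrite ltn_neqAle n0 andbT; apply/eqP => n1; subst n.
    exact: single_letter_address gK _.
  have [tab tba] := bilip_transfer_both a01 b01 m1 n1 gK gK' C1 gC.
  have ha : homogeneous (tnth rho).
    by apply: coplanar_homogeneous => // j; have /andP[] := a01 j.
  have hb : homogeneous (tnth tau).
    by apply: coplanar_homogeneous => // j; have /andP[] := b01 j.
  have [p [q [p0 q0 pq]]] := power_identity a01 b01 m1 n1 ha hb tab tba.
  exists p, q; split=> //; apply: perm_eq_power_sums => t.
  by rewrite !power_sum_iteration.
move=> [p [q [p0 q0 pe]]].
have [E [phi [simE attE dustE]]] := hDrho; have [F [psi [simF attF dustF]]] := hDtau.
have [pi [c [B piE]]] := dustlike_coding a01 simE attE dustE.
have [pi' [c' [B' piF]]] := dustlike_coding b01 simF attF dustF.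
have [g [g' [C [gK gK' C0 gC]]]] := iterates_comparable i0 j0 a01 b01 p0 q0 pe.
exists E, F; split; [by exists phi | by exists psi |].
exact: (addresses_lipschitz a01 b01 piE piF i0 gK gK' C0 gC).
Qed.
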